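(* Let $m\ge1$ be an integer and $f(z)=\sum_{n\ge0}a_nz^{-n/m}$ a Gevrey-1 series whose Borel transform $\widetilde f(\zeta)=\sum_{n\ge1}\frac{a_n\zeta^{n/m-1}}{\Gamma(n/m)}$ extends analytically to $\Omega^\star$ with $|\widetilde f(\zeta)\zeta^{\frac{m-1}{m}}|\le Ae^{B|\zeta|}$ for all $\zeta\in\Omega^\star$, for some $A>0$, $B>0$. Define $d_n$ ($n\ge1$) by: for $l=1,\dots,m$, $\widetilde g_l(\xi)=\big(\frac{\xi}{1-e^{-\xi}}\big)^{\frac lm-1}\sum_{k\ge0}\frac{a_{l+mk}\xi^k}{\Gamma(\frac lm+k)}$ (principal branch, extended holomorphically to $\Delta$) and $\widetilde g_l(-\ln s)=\sum_{j\ge0}d_{l+mj}(1-s)^j$ for $s\in D(1,1)$. Then for every $C>\max(B,1)$ the series $\sum_{n\ge1}\frac{|d_n|}{(n/m)^C}$ converges.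
   Context: $\Delta$ is the image of the open disc $D(1,1)=\{s:|s-1|<1\}$ under $s\mapsto-\ln s$ (principal logarithm); $\Delta^\star=\Delta\setminus\{0\}$. $\mathbb{C}_m^\star$ is the $m$-sheeted covering of $\mathbb{C}^\star$ (points $(|x|,\arg x)$, $\arg x\in\mathbb{R}/2\pi m\mathbb{Z}$, projection $\pi(x)=|x|e^{i\arg x}$; $x^{k/m}$ has modulus $|x|^{k/m}$ and argument $\frac km\arg x$), and $\Omega^\star=\pi^{-1}(\Delta^\star)$. Gevrey-1 means $|a_n|\le CK^n\Gamma(1+n/m)$. *)

(* Defs.v *)
From Stdlib Require Import Reals.
From Coquelicot Require Import Coquelicot.
Open Scope R_scope.

Definition Gamma (x : R) : R :=
  RInt_gen (fun t => Rpower t (x - 1) * exp (- t)) (at_right 0) (Rbar_locally p_infty).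

Definition Cexpc (z : C) : C :=
  (exp (Re z) * cos (Im z), exp (Re z) * sin (Im z)).

Definition Cargp (z : C) : R :=
  let x := Re z in let y := Im z in
  if Rlt_dec 0 x then atan (y / x)
  else if Rlt_dec x 0 then
         (if Rle_dec 0 y then atan (y / x) + PI else atan (y / x) - PI)
  else if Rlt_dec 0 y then PI / 2
  else if Rlt_dec y 0 then - (PI / 2) else 0.

Definition Clogp (z : C) : C := (ln (Cmod z), Cargp z).

Definition Cpowr (z : C) (alpha : R) : C := Cexpc (RtoC alpha * Clogp z)%C.

Definition CpowZ (z : C) (k : Z) : C :=
  match k with
  | Z0 => 1
  | Zpos p => pow_n z (Pos.to_nat p)
  | Zneg p => Cinv (pow_n z (Pos.to_nat p))
  end.

Definition D11 (s : C) : Prop := Cmod (s - 1)%C < 1.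

Definition DeltaDom (xi : C) : Prop := exists s, D11 s /\ xi = (- Clogp s)%C.

(* The m-sheeted covering C*_m of C* is modelled by the chart
   w in C \ {0}, with the point x = (|x|, arg x) corresponding to
   w = |x|^(1/m) e^(i arg x / m); then pi(x) = w^m and x^(k/m) = w^k.
   Omega^star = pi^{-1}(Delta^star) is then {w <> 0 | w^m in Delta}. *)
Definition cov_proj (m : nat) (w : C) : C := pow_n w m.
Definition Omega_star (m : nat) (w : C) : Prop := w <> 0 /\ DeltaDom (cov_proj m w).

Definition holomorphic_on (U : C -> Prop) (f : C -> C) : Prop :=
  forall z, U z -> ex_derive f z.

Definition gevrey1 (m : nat) (a : nat -> C) : Prop :=
  exists Cst K : R, forall n, Cmod (a n) <= Cst * K ^ n * Gamma (1 + INR n / INR m).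

(* Main.v *)
Require Import Defs.
From Stdlib Require Import Reals Lra Lia.
From Coquelicot Require Import Coquelicot.
Open Scope R_scope.

(** The [m]-th powers of [g_l(w^m)] and of the [m]-th-root-of-unity component of
    [w^(m-1) Ft(w)] are related near [0] by an identity free of branches; the identity
    theorem carries it to all of [Omega*], and the growth hypothesis on [Ft] becomes
    [|g_l(- ln s)| <= K |s|^(-beta)] on [D(1,1)] for any [beta > 1] with [beta >= B].
    Averaging over roots of unity on the circle [|1 - s| = 1 - 1/(j+2)] (a discrete Cauchy
    estimate) then gives [d_(l+mj) = O(j^(beta-1))], which is summable against [n^(-C)]
    once [beta < C].

    Holomorphy is mere complex differentiability, so the identity theorem rests on
    Goursat's lemma for squares.  In the half-plane it follows by integrating against the
    kernel [exp (N (v - v0)^2)] and letting [N] grow; discs reduce to half-planes through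
    [v |-> p + exp v]; and [Omega*] is a union of rays because [Delta] is star-shaped. *)

(** * Complex differentiability and the exponential *)

(** On [D(1,1)] the modulus of [- ln s] is at most [- ln |s|] plus a constant, so the exponential
    rate [B] in [xi] becomes a power singularity at [s = 0], a boundary point of the disc of
    convergence. On the circle of radius [1 - x] about 1 the mean of [|s|^(-beta)] is of order
    [x^(1-beta)] when [beta > 1], while its maximum is of order [x^(-beta)]. Working with means
    rather than suprema gains exactly the one power that makes every [C > max(B,1)] sufficient. The
    case [B <= 1] is absorbed by enlarging the exponent to some [beta > 1], whence the 1 in the
    maximum. With [x = 1/(j+2)] the factor [(1-x)^(-j)] stays bounded by 3. The mean runs over
    finitely many points because a power series is then handled by exchanging two finite sums, up to
    a tail that vanishes as the number of points grows; no contour integral over the circle has to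
    be set up. *)

Lemma exp_le_compat (x y : R) : x <= y -> exp x <= exp y.
Proof. intros [H| ->]; [left; now apply exp_increasing|apply Rle_refl]. Qed.

Lemma pow_n_Cpow (z : C) (n : nat) : pow_n z n = (z ^ n)%C.
Proof. induction n as [|n IH]; simpl; [reflexivity | now rewrite IH]. Qed.

Lemma Cmod_triangle_inv (x y : C) : Cmod x - Cmod y <= Cmod (x - y)%C.
Proof.
  generalize (Cmod_triangle (x - y)%C y).
  replace (x - y + y)%C with x by ring. lra.
Qed.

Lemma im_le_Cmod (z : C) : Rabs (Im z) <= Cmod z.
Proof. eapply Rle_trans; [|apply Rmax_Cmod]. apply Rmax_r. Qed.

Lemma Cmod_le_Re_Im (z : C) : Cmod z <= Rabs (Re z) + Rabs (Im z).
Proof.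
  destruct z as [x y]. unfold Re, Im; simpl.
  replace (x, y) with (RtoC x + Ci * RtoC y)%C
    by (unfold RtoC, Ci, Cplus, Cmult; simpl; f_equal; ring).
  eapply Rle_trans; [apply Cmod_triangle|].
  rewrite Cmod_mult, Cmod_Ci, !Cmod_R. lra.
Qed.

Lemma ex_derive_C_eps (f : C -> C) (z : C) :
  ex_derive f z <->
  exists l : C, forall eps : posreal, exists delta : posreal,
    forall w, Cmod (w - z)%C < delta ->
      Cmod (f w - f z - (w - z) * l)%C <= eps * Cmod (w - z)%C.
Proof.
  split.
  - intros [l [_ H]]. exists l. intros eps.
    destruct (H z (fun P HP => HP) eps) as [delta Hd].
    exists delta. intros w Hw. exact (Hd w Hw).
  - intros [l H]. exists l. split; [apply (is_linear_scal_l (V := C_NormedModule))|].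
    intros x Hx eps.
    assert (E : z = x) by now apply (is_filter_lim_locally_unique (V := AbsRing_NormedModule C_AbsRing)).
    subst x. destruct (H eps) as [delta Hd]. exists delta. intros w Hw. exact (Hd w Hw).
Qed.

(* Products and compositions are available in Coquelicot only for the target
   [AbsRing_NormedModule C_AbsRing], whose uniform structure is not convertible to
   that of [C_NormedModule]. *)
Lemma is_derive_C_AbsRing (f : C -> C) (z l : C) :
  is_derive (V := AbsRing_NormedModule C_AbsRing) f z l <->
  is_derive (V := C_NormedModule) f z l.
Proof.
  split; intros [_ H]; (split; [apply is_linear_scal_l|]);
    intros x Hx eps; exact (H x Hx eps).
Qed.

Lemma ex_derive_C_const (c z : C) : ex_derive (fun _ : C => c) z.
Proof. apply ex_derive_const. Qed.

Lemma ex_derive_C_id (z : C) : ex_derive (fun w : C => w) z.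
Proof. exists (one (K := C_AbsRing)). apply is_derive_C_AbsRing, (is_derive_id (K := C_AbsRing)). Qed.

Lemma ex_derive_C_plus (f g : C -> C) (z : C) :
  ex_derive f z -> ex_derive g z -> ex_derive (fun w => f w + g w)%C z.
Proof. apply (ex_derive_plus (V := C_NormedModule)). Qed.

Lemma ex_derive_C_minus (f g : C -> C) (z : C) :
  ex_derive f z -> ex_derive g z -> ex_derive (fun w => f w - g w)%C z.
Proof. apply (ex_derive_minus (V := C_NormedModule)). Qed.

Lemma ex_derive_C_mult (f g : C -> C) (z : C) :
  ex_derive f z -> ex_derive g z -> ex_derive (fun w => f w * g w)%C z.
Proof.
  intros [l Hl] [k Hk]. eexists. apply is_derive_C_AbsRing.
  apply (is_derive_mult (K := C_AbsRing) f g z l k); [| |exact Cmult_comm];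
    now apply is_derive_C_AbsRing.
Qed.

Lemma ex_derive_C_comp (f g : C -> C) (z : C) :
  ex_derive f (g z) -> ex_derive g z -> ex_derive (fun w => f (g w)) z.
Proof.
  intros Hf [l Hl].
  apply (ex_derive_comp (K := C_AbsRing) (V := C_NormedModule) f g z); [exact Hf|].
  exists l. now apply is_derive_C_AbsRing.
Qed.

Lemma ex_derive_C_pow (f : C -> C) (n : nat) (z : C) :
  ex_derive f z -> ex_derive (fun w => f w ^ n)%C z.
Proof.
  intros H. induction n as [|n IH]; simpl;
    [apply ex_derive_C_const | now apply ex_derive_C_mult].
Qed.

Lemma ex_derive_C_scal (k z : C) : ex_derive (fun w => k * w)%C z.
Proof. apply ex_derive_C_mult; [apply ex_derive_C_const | apply ex_derive_C_id]. Qed.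

Lemma ex_derive_C_continuous (f : C -> C) (z : C) :
  ex_derive f z ->
  forall eps, 0 < eps -> exists delta, 0 < delta /\
    forall w, Cmod (w - z)%C < delta -> Cmod (f w - f z)%C < eps.
Proof.
  intros H eps He. apply ex_derive_C_eps in H. destruct H as [l H].
  destruct (H (mkposreal 1 Rlt_0_1)) as [d Hd]. simpl in Hd.
  pose proof (Cmod_ge_0 l).
  exists (Rmin d (eps / (2 + Cmod l))). split.
  - apply Rmin_pos; [apply cond_pos|]. apply Rdiv_lt_0_compat; lra.
  - intros w Hw.
    assert (H1 : Cmod (w - z)%C < d) by (eapply Rlt_le_trans; [exact Hw|apply Rmin_l]).
    assert (H2 : Cmod (w - z)%C < eps / (2 + Cmod l))
      by (eapply Rlt_le_trans; [exact Hw|apply Rmin_r]).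
    replace (f w - f z)%C with ((f w - f z - (w - z) * l) + (w - z) * l)%C by ring.
    eapply Rle_lt_trans; [apply Cmod_triangle|]. rewrite Cmod_mult.
    specialize (Hd w H1). pose proof (Cmod_ge_0 (w - z)%C).
    apply Rle_lt_trans with (Cmod (w - z)%C * (2 + Cmod l)); [lra|].
    apply Rmult_lt_compat_r with (r := 2 + Cmod l) in H2; [|lra].
    unfold Rdiv in H2. rewrite Rmult_assoc, Rinv_l in H2; lra.
Qed.

Lemma Cexpc_plus (z w : C) : Cexpc (z + w)%C = (Cexpc z * Cexpc w)%C.
Proof.
  destruct z as [x y], w as [x' y']. unfold Cexpc, Cmult, Re, Im; simpl.
  rewrite exp_plus, cos_plus, sin_plus. f_equal; ring.
Qed.

Lemma Cexpc_0 : Cexpc 0%C = 1%C.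
Proof.
  unfold Cexpc, Re, Im; simpl. rewrite exp_0, cos_0, sin_0.
  unfold RtoC. f_equal; ring.
Qed.

Lemma Cmod_Cexpc (z : C) : Cmod (Cexpc z) = exp (Re z).
Proof.
  unfold Cexpc, Cmod; simpl.
  replace (_ + _) with (exp (Re z) * exp (Re z) * ((sin (Im z))² + (cos (Im z))²))
    by (unfold Rsqr; ring).
  rewrite sin2_cos2, Rmult_1_r. apply sqrt_square. left; apply exp_pos.
Qed.

Lemma Cexpc_neq_0 (z : C) : Cexpc z <> 0%C.
Proof.
  apply Cmod_gt_0. rewrite Cmod_Cexpc. apply exp_pos.
Qed.

Lemma Cexpc_pow (z : C) (n : nat) : (Cexpc z ^ n)%C = Cexpc (RtoC (INR n) * z)%C.
Proof.
  induction n as [|n IH].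
  - simpl. rewrite <- Cexpc_0. f_equal. ring.
  - rewrite S_INR, RtoC_plus. simpl. rewrite IH, <- Cexpc_plus. f_equal. ring.
Qed.

Lemma is_derive_eps_at_0 (f : R -> R) (l : R) :
  is_derive f 0 l -> forall eps, 0 < eps -> exists delta, 0 < delta /\
    forall x, Rabs x < delta -> Rabs (f x - f 0 - l * x) <= eps * Rabs x.
Proof.
  intros [_ H] eps He.
  destruct (H 0 (fun P HP => HP) (mkposreal eps He)) as [d Hd].
  exists d. split; [apply cond_pos|]. intros x Hx.
  specialize (Hd x). unfold norm, minus, plus, opp, scal in Hd; simpl in Hd.
  unfold abs, mult in Hd; simpl in Hd.
  replace (x + - 0) with x in Hd by ring.
  replace (f x - f 0 - l * x) with (f x + - f 0 + - (x * l)) by ring.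
  apply Hd. unfold ball; simpl; unfold AbsRing_ball, abs, minus, plus, opp; simpl.
  now rewrite Ropp_0, Rplus_0_r.
Qed.

(** The first-order expansions of [exp], [cos] and [sin] at 0 are multiplied out. By the addition
    formula this one point gives the derivative everywhere. *)
Lemma Cexpc_expand_0 : forall eps, 0 < eps -> exists delta, 0 < delta /\
  forall h, Cmod h < delta -> Cmod (Cexpc h - 1 - h)%C <= eps * Cmod h.
Proof.
  intros eps He.
  assert (De : is_derive exp 0 1) by (rewrite <- exp_0; apply is_derive_exp).
  assert (Dc : is_derive cos 0 0)
    by (replace 0 with (- sin 0) at 2 by (rewrite sin_0; ring); apply is_derive_cos).
  assert (Ds : is_derive sin 0 1) by (rewrite <- cos_0; apply is_derive_sin).
  (* The real part of the remainder contributes [4 e |h|] and the imaginary part [5 e |h|], together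
     below [12 e |h|]; [e <= 1] keeps the factor [1 + x + e1] below 3. *)
  set (e := Rmin 1 (eps / 12)).
  assert (He0 : 0 < e) by (apply Rmin_pos; lra).
  assert (He1 : e <= 1) by apply Rmin_l.
  assert (He2 : e <= eps / 12) by apply Rmin_r.
  destruct (is_derive_eps_at_0 _ _ De e He0) as [d1 [P1 D1]].
  destruct (is_derive_eps_at_0 _ _ Dc e He0) as [d2 [P2 D2]].
  destruct (is_derive_eps_at_0 _ _ Ds e He0) as [d3 [P3 D3]].
  exists (Rmin (Rmin d1 e) (Rmin d2 d3)). split.
  { repeat apply Rmin_pos; lra. }
  intros h Hh.
  assert (Hd1 : Cmod h < d1).
  { eapply Rlt_le_trans; [exact Hh|]. eapply Rle_trans; [apply Rmin_l|apply Rmin_l]. }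
  assert (Hde : Cmod h < e).
  { eapply Rlt_le_trans; [exact Hh|]. eapply Rle_trans; [apply Rmin_l|apply Rmin_r]. }
  assert (Hd2 : Cmod h < d2).
  { eapply Rlt_le_trans; [exact Hh|]. eapply Rle_trans; [apply Rmin_r|apply Rmin_l]. }
  assert (Hd3 : Cmod h < d3).
  { eapply Rlt_le_trans; [exact Hh|]. eapply Rle_trans; [apply Rmin_r|apply Rmin_r]. }
  pose proof (re_le_Cmod h) as Hx. pose proof (im_le_Cmod h) as Hy.
  set (c := Cmod h) in *.
  destruct h as [x y]. unfold Re, Im in Hx, Hy; simpl in Hx, Hy.
  specialize (D1 x ltac:(lra)). specialize (D2 y ltac:(lra)). specialize (D3 y ltac:(lra)).
  rewrite exp_0 in D1. rewrite cos_0 in D2. rewrite sin_0 in D3.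
  pose proof (Rabs_pos x) as Ax. pose proof (Rabs_pos y) as Ay.
  set (e1 := exp x - 1 - 1 * x) in *. set (e2 := cos y - 1 - 0 * y) in *.
  set (e3 := sin y - 0 - 1 * y) in *.
  assert (Ee : exp x = 1 + x + e1) by (unfold e1; ring).
  assert (Ec : cos y = 1 + e2) by (unfold e2; ring).
  assert (Es : sin y = y + e3) by (unfold e3; ring).
  eapply Rle_trans; [apply Cmod_le_Re_Im|].
  unfold Cexpc, Re, Im; simpl. rewrite Ee, Ec, Es.
  replace ((1 + x + e1) * (1 + e2) + - (1) + - x) with (e1 + (1 + x + e1) * e2) by ring.
  replace ((1 + x + e1) * (y + e3) + - 0 + - y) with ((x + e1) * y + (1 + x + e1) * e3) by ring.
  assert (B1 : Rabs e1 <= e * c) by nra.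
  assert (B2 : Rabs e2 <= e * c) by nra.
  assert (B3 : Rabs e3 <= e * c) by nra.
  assert (B4 : Rabs (1 + x + e1) <= 3).
  { eapply Rle_trans; [apply Rabs_triang|].
    eapply Rle_trans; [apply Rplus_le_compat_r, Rabs_triang|].
    rewrite Rabs_R1. nra. }
  assert (B5 : Rabs (x + e1) <= 2 * e).
  { eapply Rle_trans; [apply Rabs_triang|]. nra. }
  assert (C1 : Rabs (e1 + (1 + x + e1) * e2) <= 4 * e * c).
  { eapply Rle_trans; [apply Rabs_triang|]. rewrite Rabs_mult.
    pose proof (Rabs_pos e2). nra. }
  assert (C2 : Rabs ((x + e1) * y + (1 + x + e1) * e3) <= 5 * e * c).
  { eapply Rle_trans; [apply Rabs_triang|]. rewrite !Rabs_mult.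
    pose proof (Rabs_pos e3). nra. }
  assert (0 <= c) by lra. nra.
Qed.

Lemma ex_derive_Cexpc (z : C) : ex_derive Cexpc z.
Proof.
  apply ex_derive_C_eps. exists (Cexpc z). intros eps.
  pose proof (Cmod_gt_0 (Cexpc z)) as [HM _]. specialize (HM (Cexpc_neq_0 z)).
  destruct (Cexpc_expand_0 (eps / Cmod (Cexpc z))) as [d [Hd D]].
  { apply Rdiv_lt_0_compat; [apply cond_pos|exact HM]. }
  exists (mkposreal d Hd). intros w Hw. simpl in Hw. specialize (D _ Hw).
  replace (Cexpc w) with (Cexpc z * Cexpc (w - z))%C
    by (rewrite <- Cexpc_plus; f_equal; ring).
  replace (Cexpc z * Cexpc (w - z) - Cexpc z - (w - z) * Cexpc z)%C
    with (Cexpc z * (Cexpc (w - z) - 1 - (w - z)))%C by ring.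
  rewrite Cmod_mult.
  apply Rmult_le_compat_l with (r := Cmod (Cexpc z)) in D; [|lra].
  replace (Cmod (Cexpc z) * (eps / Cmod (Cexpc z) * Cmod (w - z)%C))
    with (eps * Cmod (w - z)%C) in D by (field; lra).
  exact D.
Qed.

Lemma Cmod_factor (x y : R) : x <> 0 -> Cmod (x, y) = Rabs x * sqrt (1 + (y / x)²).
Proof.
  intros Hx. unfold Cmod; simpl.
  replace (x * (x * 1) + y * (y * 1)) with (x² * (1 + (y / x)²))
    by (unfold Rsqr; field; exact Hx).
  rewrite sqrt_mult; [now rewrite sqrt_Rsqr_abs|apply Rle_0_sqr|].
  pose proof (Rle_0_sqr (y / x)). lra.
Qed.

Lemma Cexpc_Clogp (z : C) : z <> 0%C -> Cexpc (Clogp z) = z.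
Proof.
  intros Hz. pose proof (proj1 (Cmod_gt_0 z) Hz) as Hm.
  destruct z as [x y]. unfold Cexpc, Clogp, Cargp, Re, Im; simpl.
  rewrite exp_ln by exact Hm.
  assert (Hs : forall t, sqrt (1 + t²) <> 0).
  { intros t. apply Rgt_not_eq, sqrt_lt_R0. pose proof (Rle_0_sqr t). lra. }
  destruct (Rlt_dec 0 x) as [Hx|Hx].
  - rewrite Cmod_factor, cos_atan, sin_atan, (Rabs_pos_eq x) by lra.
    f_equal; field; repeat split; try apply Hs; lra.
  - destruct (Rlt_dec x 0) as [Hx'|Hx'].
    + rewrite Cmod_factor, (Rabs_left x) by lra.
      destruct (Rle_dec 0 y).
      * rewrite neg_cos, neg_sin, cos_atan, sin_atan.
        f_equal; field; repeat split; try apply Hs; lra.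
      * replace (atan (y / x) - PI) with (- (- atan (y / x) + PI)) by ring.
        rewrite cos_neg, sin_neg, neg_cos, neg_sin, cos_neg, sin_neg, cos_atan, sin_atan.
        f_equal; field; repeat split; try apply Hs; lra.
    + assert (x = 0) by lra. subst x.
      assert (Hy : Cmod (0, y) = Rabs y).
      { unfold Cmod; simpl. replace (0 * (0 * 1) + y * (y * 1)) with (y²) by (unfold Rsqr; ring).
        apply sqrt_Rsqr_abs. }
      rewrite Hy.
      destruct (Rlt_dec 0 y).
      * rewrite cos_PI2, sin_PI2, Rabs_pos_eq by lra. f_equal; ring.
      * destruct (Rlt_dec y 0).
        -- rewrite cos_neg, sin_neg, cos_PI2, sin_PI2, Rabs_left by lra. f_equal; ring.
        -- exfalso. apply Hz. unfold RtoC. f_equal. lra.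
Qed.

(** * Goursat's lemma for squares *)

Lemma nested_intervals (x : nat -> R) (h : nat -> R) :
  (forall n, x n <= x (S n)) -> (forall n, x (S n) + h (S n) <= x n + h n) ->
  (forall n, 0 <= h n) ->
  exists X, forall n, x n <= X <= x n + h n.
Proof.
  intros Hx Hh Hp.
  assert (Hxm : forall n k, x n <= x (n + k)%nat).
  { intros n k; induction k as [|k IH]; [rewrite Nat.add_0_r; lra|].
    rewrite Nat.add_succ_r. eapply Rle_trans; [exact IH|apply Hx]. }
  assert (Hhm : forall n k, x (n + k)%nat + h (n + k)%nat <= x n + h n).
  { intros n k; induction k as [|k IH]; [rewrite Nat.add_0_r; lra|].
    rewrite Nat.add_succ_r. eapply Rle_trans; [apply Hh|exact IH]. }
  assert (Hxy : forall n k, x n <= x k + h k).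
  { intros n k. destruct (Nat.le_ge_cases n k) as [L|L].
    - replace k with (n + (k - n))%nat by lia.
      pose proof (Hxm n (k - n)%nat); pose proof (Hp (n + (k - n))%nat); lra.
    - replace n with (k + (n - k))%nat by lia.
      pose proof (Hhm k (n - k)%nat); pose proof (Hp (k + (n - k))%nat); lra. }
  destruct (completeness (fun r => exists n, r = x n)) as [X [HX1 HX2]].
  - exists (x 0%nat + h 0%nat). intros r [n ->]. apply Hxy.
  - now exists (x 0%nat), 0%nat.
  - exists X. intros n. split.
    + apply HX1. now exists n.
    + apply HX2. intros r [k ->]. apply Hxy.
Qed.

Section SquareBisection.

Variable P : R -> R -> R -> Prop.
Hypothesis P_dec : forall x y h, {P x y h} + {~ P x y h}.
Variables x0 y0 h0 : R.
Hypothesis h0_ge0 : 0 <= h0.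

Definition subsquare (x y h : R) : Prop :=
  0 <= h /\ x0 <= x /\ x + h <= x0 + h0 /\ y0 <= y /\ y + h <= y0 + h0.

Hypothesis P_quarters : forall x y k, subsquare x y (k + k) ->
  P x y k -> P (x + k) y k -> P x (y + k) k -> P (x + k) (y + k) k -> P x y (k + k).

Hypothesis P_local : forall X Y, x0 <= X <= x0 + h0 -> y0 <= Y <= y0 + h0 ->
  exists delta, 0 < delta /\ forall x y h, subsquare x y h -> h < delta ->
    x <= X <= x + h -> y <= Y <= y + h -> P x y h.

(** The last quarter is returned untested: if the other three satisfy [P] and the whole square does
    not, [P_quarters] forces the failure to lie there. *)
Definition bad_quarter (k : R) (p : R * R) : R * R :=
  let (x, y) := p in
  if P_dec x y k then
    if P_dec (x + k) y k then
      if P_dec x (y + k) k then (x + k, y + k) else (x, y + k)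
    else (x + k, y)
  else (x, y).

Definition side (n : nat) : R := h0 / 2 ^ n.

Fixpoint corner (n : nat) : R * R :=
  match n with
  | O => (x0, y0)
  | S n => bad_quarter (side (S n)) (corner n)
  end.

Lemma side_S (n : nat) : side n = side (S n) + side (S n).
Proof. unfold side; simpl. field. apply pow_nonzero; lra. Qed.

Lemma side_ge0 (n : nat) : 0 <= side n.
Proof.
  unfold side. apply Rmult_le_pos; [exact h0_ge0|].
  left; apply Rinv_0_lt_compat, pow_lt; lra.
Qed.

Lemma corner_step (n : nat) :
  (fst (corner n) <= fst (corner (S n)) <= fst (corner n) + side (S n)) /\
  (snd (corner n) <= snd (corner (S n)) <= snd (corner n) + side (S n)).
Proof.
  pose proof (side_ge0 (S n)). simpl. destruct (corner n) as [x y]. unfold bad_quarter.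
  destruct (P_dec _ _ _); [destruct (P_dec _ _ _); [destruct (P_dec _ _ _)|]|]; simpl; lra.
Qed.

Lemma corner_subsquare (n : nat) : subsquare (fst (corner n)) (snd (corner n)) (side n).
Proof.
  induction n as [|n IH].
  - unfold subsquare, side; simpl. lra.
  - destruct (corner_step n). unfold subsquare in *. pose proof (side_ge0 (S n)).
    rewrite side_S in IH. lra.
Qed.

Lemma corner_bad (n : nat) : ~ P x0 y0 h0 -> ~ P (fst (corner n)) (snd (corner n)) (side n).
Proof.
  intros H0. induction n as [|n IH].
  - unfold side; simpl. now rewrite Rdiv_1_r.
  - pose proof (corner_subsquare n) as Hs. simpl. destruct (corner n) as [x y].
    simpl in IH, Hs. unfold bad_quarter.
    rewrite side_S in IH, Hs. specialize (P_quarters x y (side (S n)) Hs).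
    destruct (P_dec _ _ _); [destruct (P_dec _ _ _); [destruct (P_dec _ _ _)|]|]; simpl; tauto.
Qed.

(** Bisection as an induction principle. If [P] failed, failing quarters would shrink to a point
    [(X, Y)] of the closed square, and [P_local] at that point contradicts the failure of a
    sufficiently small one. *)
Lemma square_bisection : P x0 y0 h0.
Proof.
  destruct (P_dec x0 y0 h0) as [H|H0]; [exact H|exfalso].
  destruct (nested_intervals (fun n => fst (corner n)) side) as [X HX].
  { intros n; apply corner_step. }
  { intros n. rewrite (side_S n). pose proof (corner_step n). lra. }
  { apply side_ge0. }
  destruct (nested_intervals (fun n => snd (corner n)) side) as [Y HY].
  { intros n; apply corner_step. }
  { intros n. rewrite (side_S n). pose proof (corner_step n). lra. }
  { apply side_ge0. }
  destruct (P_local X Y) as [delta [Hd HP]].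
  { pose proof (HX 0%nat) as H. unfold side in H; simpl in H. lra. }
  { pose proof (HY 0%nat) as H. unfold side in H; simpl in H. lra. }
  (* The denominator [h0 + 1] rather than [h0] also covers a degenerate square. *)
  destruct (pow_lt_1_zero (/ 2)) with (y := delta / (h0 + 1)) as [N HN].
  { rewrite Rabs_pos_eq; lra. }
  { apply Rdiv_lt_0_compat; lra. }
  specialize (HN N (Nat.le_refl N)).
  apply (corner_bad N H0), HP; [apply corner_subsquare| |apply HX|apply HY].
  unfold side, Rdiv. rewrite <- pow_inv.
  rewrite Rabs_pos_eq in HN by (apply pow_le; lra).
  pose proof (pow_lt (/ 2) N ltac:(lra)).
  apply Rmult_lt_compat_l with (r := h0 + 1) in HN; [|lra].
  replace ((h0 + 1) * (delta / (h0 + 1))) with delta in HN by (field; lra).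
  nra.
Qed.

End SquareBisection.

Definition in_square (x y h : R) (z : C) : Prop :=
  x <= Re z <= x + h /\ y <= Im z <= y + h.

Definition hint (f : C -> C) (x y h : R) : R := RInt (fun t => Re (f (x + t, y))) 0 h.
(** On an upward segment [dz = i dt], so the real part of the integral of [f dz] is minus this
    quantity. Hence the signs in [square_int] for a counterclockwise boundary. *)
Definition vint (f : C -> C) (x y h : R) : R := RInt (fun t => Im (f (x, y + t))) 0 h.

(* The real part of the integral of [f dz] along the boundary of a square; the
   imaginary part is recovered by replacing [f] with [- i f]. *)
Definition square_int (f : C -> C) (x y h : R) : R :=
  hint f x y h - vint f (x + h) y h - hint f x (y + h) h + vint f x y h.

Lemma continuous_along (f : C -> C) (p : R -> C) (pr : C -> R) (t : R) :
  (forall z, Rabs (pr z) <= Cmod z) -> (forall z w, pr (z - w)%C = pr z - pr w) ->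
  (forall s, Cmod (p s - p t)%C <= Rabs (s - t)) ->
  ex_derive f (p t) -> continuous (fun s => pr (f (p s))) t.
Proof.
  intros Hpr Hlin Hp Hf.
  apply filterlim_locally. intros eps.
  destruct (ex_derive_C_continuous f _ Hf eps (cond_pos eps)) as [d [Hd D]].
  exists (mkposreal d Hd). intros s Hs.
  change (Rabs (pr (f (p s)) - pr (f (p t))) < eps).
  change (Rabs (s - t) < d) in Hs.
  rewrite <- Hlin. eapply Rle_lt_trans; [apply Hpr|].
  apply D. eapply Rle_lt_trans; [apply Hp|exact Hs].
Qed.

Lemma continuous_horizontal (f : C -> C) (x y t : R) :
  ex_derive f (x + t, y) -> continuous (fun t => Re (f (x + t, y))) t.
Proof.
  apply (continuous_along f (fun t => (x + t, y)) Re); [apply re_le_Cmod|reflexivity|].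
  intros s. eapply Rle_trans; [apply Cmod_le_Re_Im|]. unfold Re, Im; simpl.
  replace (x + s + - (x + t)) with (s - t) by ring.
  replace (y + - y) with 0 by ring. rewrite Rabs_R0. lra.
Qed.

Lemma continuous_vertical (f : C -> C) (x y t : R) :
  ex_derive f (x, y + t) -> continuous (fun t => Im (f (x, y + t))) t.
Proof.
  apply (continuous_along f (fun t => (x, y + t)) Im); [apply im_le_Cmod|reflexivity|].
  intros s. eapply Rle_trans; [apply Cmod_le_Re_Im|]. unfold Re, Im; simpl.
  replace (y + s + - (y + t)) with (s - t) by ring.
  replace (x + - x) with 0 by ring. rewrite Rabs_R0. lra.
Qed.

Lemma ex_RInt_horizontal (f : C -> C) (x y h : R) : 0 <= h ->
  (forall t, 0 <= t <= h -> ex_derive f (x + t, y)) ->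
  ex_RInt (fun t => Re (f (x + t, y))) 0 h.
Proof.
  intros Hh H. apply (ex_RInt_continuous (V := R_CompleteNormedModule)).
  intros t. rewrite Rmin_left, Rmax_right by lra. intros Ht.
  now apply continuous_horizontal, H.
Qed.

Lemma ex_RInt_vertical (f : C -> C) (x y h : R) : 0 <= h ->
  (forall t, 0 <= t <= h -> ex_derive f (x, y + t)) ->
  ex_RInt (fun t => Im (f (x, y + t))) 0 h.
Proof.
  intros Hh H. apply (ex_RInt_continuous (V := R_CompleteNormedModule)).
  intros t. rewrite Rmin_left, Rmax_right by lra. intros Ht.
  now apply continuous_vertical, H.
Qed.

Lemma RInt_half (g : R -> R) (k : R) : 0 <= k -> ex_RInt g 0 (k + k) ->
  RInt g 0 (k + k) = RInt g 0 k + RInt (fun t => g (k + t)) 0 k.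
Proof.
  intros Hk Hg.
  assert (H1 : ex_RInt g 0 k) by (apply (ex_RInt_Chasles_1 (V := R_CompleteNormedModule)) with (k + k); [lra|exact Hg]).
  assert (H2 : ex_RInt g k (k + k)) by (apply (ex_RInt_Chasles_2 (V := R_CompleteNormedModule)) with 0; [lra|exact Hg]).
  rewrite <- (RInt_Chasles g 0 k (k + k) H1 H2).
  change plus with Rplus. f_equal.
  assert (H3 : ex_RInt g (1 * 0 + k) (1 * k + k))
    by (replace (1 * 0 + k) with k by ring; replace (1 * k + k) with (k + k) by ring; exact H2).
  pose proof (RInt_comp_lin g 1 k 0 k H3) as E.
  replace (1 * 0 + k) with k in E by ring. replace (1 * k + k) with (k + k) in E by ring.
  rewrite <- E. apply RInt_ext. intros t _.
  change (1 * g (1 * t + k) = g (k + t)). rewrite Rmult_1_l. f_equal. ring.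
Qed.

Lemma hint_half (f : C -> C) (x y k : R) : 0 <= k ->
  (forall t, 0 <= t <= k + k -> ex_derive f (x + t, y)) ->
  hint f x y (k + k) = hint f x y k + hint f (x + k) y k.
Proof.
  intros Hk H. unfold hint. rewrite RInt_half; [|exact Hk|apply ex_RInt_horizontal; [lra|exact H]].
  f_equal. apply RInt_ext. intros t _. now rewrite Rplus_assoc.
Qed.

Lemma vint_half (f : C -> C) (x y k : R) : 0 <= k ->
  (forall t, 0 <= t <= k + k -> ex_derive f (x, y + t)) ->
  vint f x y (k + k) = vint f x y k + vint f x (y + k) k.
Proof.
  intros Hk H. unfold vint. rewrite RInt_half; [|exact Hk|apply ex_RInt_vertical; [lra|exact H]].
  f_equal. apply RInt_ext. intros t _. now rewrite Rplus_assoc.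
Qed.

(** Each inner side is shared by two quarters that traverse it in opposite directions, so after
    halving the outer sides the inner contributions cancel. *)
Lemma square_int_quarters (f : C -> C) (x y k : R) : 0 <= k ->
  (forall z, in_square x y (k + k) z -> ex_derive f z) ->
  square_int f x y (k + k) =
    square_int f x y k + square_int f (x + k) y k +
    square_int f x (y + k) k + square_int f (x + k) (y + k) k.
Proof.
  intros Hk H. unfold square_int.
  rewrite (hint_half f x y), (hint_half f x (y + (k + k))),
          (vint_half f x y), (vint_half f (x + (k + k)) y);
    try exact Hk; try (intros t Ht; apply H; unfold in_square, Re, Im; simpl; lra).
  rewrite !Rplus_assoc. ring.
Qed.

(* The boundary integral of an affine function vanishes, already as an integrand once
   opposite sides are paired, so only the remainder of the derivative contributes. *)
Lemma square_int_local (f : C -> C) (z0 : C) (eps : R) : 0 < eps -> ex_derive f z0 ->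
  exists delta, 0 < delta /\ forall x y h, 0 <= h < delta -> in_square x y h z0 ->
    (forall z, in_square x y h z -> ex_derive f z) ->
    Rabs (square_int f x y h) <= eps * (h * h).
Proof.
  intros He Hf. apply ex_derive_C_eps in Hf. destruct Hf as [l Hl].
  (* Points of the square are within [2 h] of [z0], so the remainder is at most [eps / 4 * h] on
     each of the four sides, and the total is [eps * h] times the length [h]. The bound [d / 3] on
     the side keeps [2 h] below [d]. *)
  destruct (Hl (mkposreal (eps / 8) ltac:(lra))) as [d D]. simpl in D.
  exists (d / 3). split; [pose proof (cond_pos d); lra|].
  intros x y h [Hh0 Hhd] Hz0 Hdiff.
  set (rho := fun z => (f z - f z0 - (z - z0) * l)%C).
  assert (Hrho : forall z, in_square x y h z -> Cmod (rho z) <= eps / 4 * h).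
  { intros z Hz.
    assert (Cmod (z - z0)%C <= 2 * h).
    { eapply Rle_trans; [apply Cmod_le_Re_Im|].
      destruct z as [a b], z0 as [a0 b0]. unfold in_square, Re, Im in *; simpl in *.
      assert (Rabs (a + - a0) <= h) by (apply Rabs_le; lra).
      assert (Rabs (b + - b0) <= h) by (apply Rabs_le; lra). lra. }
    unfold rho. eapply Rle_trans; [apply D; pose proof (cond_pos d); lra|]. nra. }
  assert (E1 : ex_RInt (fun t => Re (f (x + t, y))) 0 h).
  { apply ex_RInt_horizontal; [lra|]. intros t Ht; apply Hdiff; unfold in_square; simpl; lra. }
  assert (E2 : ex_RInt (fun t => Im (f (x + h, y + t))) 0 h).
  { apply ex_RInt_vertical; [lra|]. intros t Ht; apply Hdiff; unfold in_square; simpl; lra. }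
  assert (E3 : ex_RInt (fun t => Re (f (x + t, y + h))) 0 h).
  { apply ex_RInt_horizontal; [lra|]. intros t Ht; apply Hdiff; unfold in_square; simpl; lra. }
  assert (E4 : ex_RInt (fun t => Im (f (x, y + t))) 0 h).
  { apply ex_RInt_vertical; [lra|]. intros t Ht; apply Hdiff; unfold in_square; simpl; lra. }
  assert (E : square_int f x y h = RInt (fun t =>
    Re (rho (x + t, y)) - Im (rho (x + h, y + t)) - Re (rho (x + t, y + h)) + Im (rho (x, y + t))) 0 h).
  { unfold square_int, hint, vint.
    symmetry. apply is_RInt_unique.
    apply (is_RInt_ext (fun t => Re (f (x + t, y)) - Im (f (x + h, y + t))
                        - Re (f (x + t, y + h)) + Im (f (x, y + t)))).
    { intros t _. unfold rho. destruct z0 as [a0 b0], l as [l1 l2].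
      unfold Cminus, Cplus, Copp, Cmult, Re, Im; simpl. ring. }
    apply (is_RInt_plus (V := R_NormedModule)); [|now apply (RInt_correct (V := R_CompleteNormedModule))].
    apply (is_RInt_minus (V := R_NormedModule)); [|now apply (RInt_correct (V := R_CompleteNormedModule))].
    apply (is_RInt_minus (V := R_NormedModule)); now apply (RInt_correct (V := R_CompleteNormedModule)). }
  rewrite E.
  assert (Hex : ex_RInt (fun t =>
    Re (rho (x + t, y)) - Im (rho (x + h, y + t)) - Re (rho (x + t, y + h)) + Im (rho (x, y + t))) 0 h).
  { apply ex_RInt_ext with (fun t => Re (f (x + t, y)) - Im (f (x + h, y + t))
                        - Re (f (x + t, y + h)) + Im (f (x, y + t))).
    { intros t _. unfold rho. destruct z0 as [a0 b0], l as [l1 l2].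
      unfold Cminus, Cplus, Copp, Cmult, Re, Im; simpl. ring. }
    apply (ex_RInt_plus (V := R_NormedModule)); [|exact E4].
    apply (ex_RInt_minus (V := R_NormedModule)); [|exact E3].
    now apply (ex_RInt_minus (V := R_NormedModule)). }
  eapply Rle_trans.
  { apply abs_RInt_le_const with (M := eps * h); [exact Hh0|exact Hex|].
    intros t Ht.
    assert (R1 : Cmod (rho (x + t, y)) <= eps / 4 * h)
      by (apply Hrho; unfold in_square; simpl; lra).
    assert (R2 : Cmod (rho (x + h, y + t)) <= eps / 4 * h)
      by (apply Hrho; unfold in_square; simpl; lra).
    assert (R3 : Cmod (rho (x + t, y + h)) <= eps / 4 * h)
      by (apply Hrho; unfold in_square; simpl; lra).
    assert (R4 : Cmod (rho (x, y + t)) <= eps / 4 * h)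
      by (apply Hrho; unfold in_square; simpl; lra).
    apply Rabs_le.
    pose proof (proj1 (Rabs_le_between _ _) (Rle_trans _ _ _ (re_le_Cmod _) R1)).
    pose proof (proj1 (Rabs_le_between _ _) (Rle_trans _ _ _ (im_le_Cmod _) R2)).
    pose proof (proj1 (Rabs_le_between _ _) (Rle_trans _ _ _ (re_le_Cmod _) R3)).
    pose proof (proj1 (Rabs_le_between _ _) (Rle_trans _ _ _ (im_le_Cmod _) R4)).
    lra. }
  nra.
Qed.

(** The estimate [eps * (h * h)] is proportional to area, hence adds up exactly over four quarters.
    This makes it inheritable by bisection, and differentiability at a single point gives it for
    small squares around that point. *)
Lemma goursat_square (f : C -> C) (x y h : R) : 0 <= h ->
  (forall z, in_square x y h z -> ex_derive f z) -> square_int f x y h = 0.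
Proof.
  intros Hh Hf.
  assert (H : forall eps, 0 < eps -> Rabs (square_int f x y h) <= eps * (h * h)).
  { intros eps He.
    apply (square_bisection (fun x y h => Rabs (square_int f x y h) <= eps * (h * h))
             (fun x y h => Rle_dec _ _) x y h Hh).
    - intros a b k Hs H1 H2 H3 H4. unfold subsquare in Hs.
      rewrite square_int_quarters; [|lra|].
      + apply Rabs_le_between in H1, H2, H3, H4. apply Rabs_le. lra.
      + intros z Hz. apply Hf. unfold in_square in *. lra.
    - intros X Y HX HY.
      destruct (square_int_local f (X, Y) eps He) as [d [Hd D]].
      { apply Hf. split; assumption. }
      exists d. split; [exact Hd|]. intros a b k Hs Hk HaX HbY. unfold subsquare in Hs.
      apply D; [lra|split; assumption|].
      intros z Hz. apply Hf. unfold in_square in *. lra. }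
  destruct (Req_dec (square_int f x y h) 0) as [E|E]; [exact E|exfalso].
  pose proof (Rabs_pos_lt _ E) as Hp.
  specialize (H (Rabs (square_int f x y h) / (2 * (h * h + 1)))).
  assert (0 <= h * h) by nra.
  assert (0 < Rabs (square_int f x y h) / (2 * (h * h + 1))) by (apply Rdiv_lt_0_compat; lra).
  specialize (H H1). set (r := Rabs (square_int f x y h)) in *.
  replace (r / (2 * (h * h + 1)) * (h * h)) with (r / 2 * (1 - / (h * h + 1))) in H by (field; lra).
  assert (0 < / (h * h + 1)) by (apply Rinv_0_lt_compat; lra). nra.
Qed.

(** * The identity theorem *)

Lemma bounded_along (f : C -> C) (p : R -> C) (a b : R) :
  (forall s t, Cmod (p s - p t)%C <= Rabs (s - t)) ->
  (forall t, a <= t <= b -> ex_derive f (p t)) ->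
  exists M, 0 < M /\ forall t, a <= t <= b -> Cmod (f (p t)) <= M.
Proof.
  intros Hp Hf.
  destruct (bounded_continuity (V := R_NormedModule) (fun t => Re (f (p t))) a b) as [M1 H1].
  { intros t Ht. apply (continuous_along f p Re t);
      [apply re_le_Cmod|reflexivity|intros s; apply Hp|now apply Hf]. }
  destruct (bounded_continuity (V := R_NormedModule) (fun t => Im (f (p t))) a b) as [M2 H2].
  { intros t Ht. apply (continuous_along f p Im t);
      [apply im_le_Cmod|reflexivity|intros s; apply Hp|now apply Hf]. }
  exists (Rabs M1 + Rabs M2 + 1). split.
  { pose proof (Rabs_pos M1); pose proof (Rabs_pos M2); lra. }
  intros t Ht. eapply Rle_trans; [apply Cmod_le_Re_Im|].
  specialize (H1 t Ht); specialize (H2 t Ht).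
  change (Rabs (Re (f (p t))) < M1) in H1. change (Rabs (Im (f (p t))) < M2) in H2.
  pose proof (Rle_abs M1); pose proof (Rle_abs M2). lra.
Qed.

Lemma RInt_ge_const (g : R -> R) (a b c : R) : a <= b -> ex_RInt g a b ->
  (forall t, a <= t <= b -> c <= g t) -> (b - a) * c <= RInt g a b.
Proof.
  intros Hab Hg H.
  replace ((b - a) * c) with (RInt (fun _ => c) a b) by (rewrite RInt_const; reflexivity).
  apply RInt_le; [exact Hab|apply ex_RInt_const|exact Hg|].
  intros t Ht; apply H; lra.
Qed.

Lemma RInt_bump_ge (g : R -> R) (a b p q c e : R) : a <= p -> p <= q -> q <= b ->
  0 <= e -> ex_RInt g a b ->
  (forall t, a <= t <= b -> - e <= g t) -> (forall t, p <= t <= q -> c <= g t) ->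
  (q - p) * c - (b - a) * e <= RInt g a b.
Proof.
  intros Hap Hpq Hqb He Hg Hlow Hmid.
  assert (G1 : ex_RInt g a q) by (apply (ex_RInt_Chasles_1 (V := R_CompleteNormedModule)) with b; [lra|exact Hg]).
  assert (G2 : ex_RInt g q b) by (apply (ex_RInt_Chasles_2 (V := R_CompleteNormedModule)) with a; [lra|exact Hg]).
  assert (G3 : ex_RInt g a p) by (apply (ex_RInt_Chasles_1 (V := R_CompleteNormedModule)) with q; [lra|exact G1]).
  assert (G4 : ex_RInt g p q) by (apply (ex_RInt_Chasles_2 (V := R_CompleteNormedModule)) with a; [lra|exact G1]).
  rewrite <- (RInt_Chasles g a q b G1 G2), <- (RInt_Chasles g a p q G3 G4).
  change plus with Rplus.
  assert (I1 : (p - a) * (- e) <= RInt g a p)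
    by (apply RInt_ge_const; [lra|exact G3|intros; apply Hlow; lra]).
  assert (I2 : (q - p) * c <= RInt g p q)
    by (apply RInt_ge_const; [lra|exact G4|intros; apply Hmid; lra]).
  assert (I3 : (b - q) * (- e) <= RInt g q b)
    by (apply RInt_ge_const; [lra|exact G2|intros; apply Hlow; lra]).
  nra.
Qed.

(* Goursat on the square of side [2 eta] whose right side is centred at [v0], applied to
   [F] times the kernel [exp (N (v - v0)^2)]: on that side the kernel is a Gaussian
   peaking at [v0], and on the horizontal sides it is small as soon as [F] is nonzero. *)
Lemma halfplane_vanish (F : C -> C) (X x0 : R) :
  (forall z, Re z < X -> ex_derive F z) -> (forall z, Re z < x0 -> F z = 0%C) ->
  forall z, Re z < X -> F z = 0%C.
Proof.
  intros HF H0 v0 Hv0.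
  destruct (Ceq_dec (F v0) 0%C) as [E|Hc0]; [exact E|exfalso].
  set (c0 := F v0) in *.
  (* Translation puts [v0] at the origin, and the factor [Cconj c0] makes [g 0 = |c0|^2] a positive
     real, so that a lower bound on [Re g] suffices. *)
  set (g := fun z : C => (Cconj c0 * F (v0 + z))%C).
  assert (Hg : forall z, Re z <= 0 -> ex_derive g z).
  { intros z Hz. apply ex_derive_C_mult; [apply ex_derive_C_const|].
    apply (ex_derive_C_comp F (fun z => v0 + z)%C).
    - apply HF. destruct v0, z. unfold Re in *; simpl in *; lra.
    - apply ex_derive_C_plus; [apply ex_derive_C_const|apply ex_derive_C_id]. }
  set (L := Rabs (Re v0 - x0) + 1).
  assert (HL : 1 <= L) by (unfold L; pose proof (Rabs_pos (Re v0 - x0)); lra).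
  assert (Hg0 : forall z, Re z <= - L -> g z = 0%C).
  { intros z Hz. unfold g. rewrite H0; [ring|].
    pose proof (Rle_abs (Re v0 - x0)). unfold L in Hz.
    destruct v0, z. unfold Re in *; simpl in *; lra. }
  (* On a horizontal side [g] can be nonzero only for [- L < Re z <= 0], where
     [Re (z * z) <= L^2 - (L + 1)^2 <= - 1]. The left side, at [- 2 eta], lies where [g]
     vanishes. *)
  set (eta := L + 1).
  destruct (bounded_along g (fun t => (- (2 * eta) + t, - eta)) 0 (2 * eta)) as [M1 [PM1 HM1]].
  { intros s t. eapply Rle_trans; [apply Cmod_le_Re_Im|]. unfold Re, Im; simpl.
    replace (- eta + - - eta) with 0 by ring. rewrite Rabs_R0.
    match goal with |- Rabs ?u + 0 <= _ => replace u with (s - t) by ring end. lra. }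
  { intros t Ht. apply Hg. unfold Re; simpl. lra. }
  destruct (bounded_along g (fun t => (- (2 * eta) + t, eta)) 0 (2 * eta)) as [M2 [PM2 HM2]].
  { intros s t. eapply Rle_trans; [apply Cmod_le_Re_Im|]. unfold Re, Im; simpl.
    replace (eta + - eta) with 0 by ring. rewrite Rabs_R0.
    match goal with |- Rabs ?u + 0 <= _ => replace u with (s - t) by ring end. lra. }
  { intros t Ht. apply Hg. unfold Re; simpl. lra. }
  destruct (bounded_along g (fun t => (0, - eta + t)) 0 (2 * eta)) as [M3 [PM3 HM3]].
  { intros s t. eapply Rle_trans; [apply Cmod_le_Re_Im|]. unfold Re, Im; simpl.
    replace (0 + - 0) with 0 by ring. rewrite Rabs_R0.
    match goal with |- 0 + Rabs ?u <= _ => replace u with (s - t) by ring end. lra. }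
  { intros t Ht. apply Hg. unfold Re; simpl. lra. }
  set (M := M1 + M2 + M3).
  set (c := Cmod c0 ^ 2 / 2).
  assert (Hc : 0 < c).
  { apply Cmod_gt_0 in Hc0. unfold c. nra. }
  assert (Hgc : Re (g 0%C) = 2 * c).
  { unfold g. rewrite Cplus_0_r. fold c0. unfold c. rewrite Cmod2_alt.
    destruct c0 as [a b]. unfold Re, Im; simpl. field. }
  destruct (ex_derive_C_continuous g 0%C (Hg 0%C ltac:(unfold Re; simpl; lra)) c Hc)
    as [d0 [Hd0 D0]].
  set (d := Rmin 1 (d0 / 2)).
  assert (Hd : 0 < d) by (apply Rmin_pos; lra).
  assert (Hd1 : d <= 1) by apply Rmin_l.
  assert (Hd2 : d < d0) by (apply Rle_lt_trans with (d0 / 2); [apply Rmin_r|lra]).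
  assert (Hnear : forall t, Rabs t <= d -> c <= Re (g (0, t))).
  { intros t Ht.
    assert (Cmod ((0, t) - 0)%C < d0).
    { eapply Rle_lt_trans; [apply Cmod_le_Re_Im|]. unfold Re, Im; simpl.
      replace (0 + - 0) with 0 by ring. replace (t + - 0) with t by ring.
      rewrite Rabs_R0. lra. }
    specialize (D0 _ H). pose proof (re_le_Cmod (g (0, t) - g 0)%C) as Hr.
    change (Re (g (0, t) - g 0)%C) with (Re (g (0, t)) - Re (g 0%C)) in Hr.
    rewrite Hgc in Hr.
    pose proof (proj1 (Rabs_le_between _ _) Hr). lra. }
  (* Chosen so that [d * c * (3 * N * d^2 / 4) = 6 * eta * M]; the inequality [1 + x <= exp x] then
     contradicts the final estimate strictly. *)
  set (N := 8 * eta * M / (c * d ^ 3)).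
  assert (HM : 0 < M) by (unfold M; lra).
  assert (Heta : 2 <= eta) by (unfold eta; lra).
  assert (HN : 0 < N).
  { unfold N. apply Rdiv_lt_0_compat; [nra|]. apply Rmult_lt_0_compat; [exact Hc|now apply pow_lt]. }
  (* The factor [Ci] turns the imaginary part integrated by [vint] into [Re g] times a real
     Gaussian. *)
  set (f := fun z : C => (Ci * (g z * Cexpc (RtoC N * (z * z))))%C).
  assert (Hf : forall z, Re z <= 0 -> ex_derive f z).
  { intros z Hz. apply ex_derive_C_mult; [apply ex_derive_C_const|].
    apply ex_derive_C_mult; [now apply Hg|].
    apply (ex_derive_C_comp Cexpc); [apply ex_derive_Cexpc|].
    apply ex_derive_C_mult; [apply ex_derive_C_const|].
    apply ex_derive_C_mult; apply ex_derive_C_id. }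
  assert (Hfmod : forall s t, Cmod (f (s, t)) = Cmod (g (s, t)) * exp (N * (s * s - t * t))).
  { intros s t. unfold f. rewrite !Cmod_mult, Cmod_Ci, Cmod_Cexpc, Rmult_1_l.
    do 2 f_equal. unfold Re; simpl. ring. }
  assert (Hfim : forall t, Im (f (0, t)) = Re (g (0, t)) * exp (- (N * (t * t)))).
  { intros t. unfold f. destruct (g (0, t)) as [a b]. unfold Cexpc, Re, Im; simpl.
    replace (N * (0 * t + t * 0) + 0 * (0 * 0 - t * t)) with 0 by ring.
    rewrite sin_0, cos_0.
    replace (N * (0 * 0 - t * t) - 0 * (0 * t + t * 0)) with (- (N * (t * t))) by ring. ring. }
  pose proof (goursat_square f (- (2 * eta)) (- eta) (2 * eta) ltac:(lra)) as HI.
  assert (HI' : square_int f (- (2 * eta)) (- eta) (2 * eta) = 0).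
  { apply HI. intros z Hz. apply Hf. unfold in_square in Hz. lra. }
  clear HI. unfold square_int in HI'.
  replace (- (2 * eta) + 2 * eta) with 0 in HI' by ring.
  replace (- eta + 2 * eta) with eta in HI' by ring.
  (* [E] is the kernel at distance [d] from the centre of the right side; since [d <= 1] it also
     dominates the bound [exp (- N)] of the horizontal sides. *)
  set (E := exp (- (N * d ^ 2))).
  assert (HE : 0 < E) by apply exp_pos.
  assert (HEN : exp (- N) <= E).
  { unfold E. apply exp_le_compat. assert (d ^ 2 <= 1) by nra. nra. }
  assert (Hleft : vint f (- (2 * eta)) (- eta) (2 * eta) = 0).
  { unfold vint. rewrite (RInt_ext _ (fun _ => 0)).
    - rewrite RInt_const. change (scal (2 * eta - 0) 0) with ((2 * eta - 0) * 0). ring.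
    - intros t _. unfold f. rewrite Hg0 by (unfold Re; simpl; unfold eta; lra).
      rewrite Cmult_0_l, Cmult_0_r. reflexivity. }
  assert (Hhor : forall y, y * y = eta * eta ->
    (forall t, 0 <= t <= 2 * eta -> Cmod (g (- (2 * eta) + t, y)) <= M) ->
    Rabs (hint f (- (2 * eta)) y (2 * eta)) <= 2 * eta * (M * E)).
  { intros y Hy HMy. replace (2 * eta) with (2 * eta - 0) at 3 by ring. unfold hint.
    apply abs_RInt_le_const; [lra| |].
    - apply ex_RInt_horizontal; [lra|]. intros t Ht; apply Hf. unfold Re; simpl; lra.
    - intros t Ht. eapply Rle_trans; [apply re_le_Cmod|]. rewrite Hfmod.
      destruct (Rle_dec (- (2 * eta) + t) (- L)) as [Hl|Hl].
      + rewrite Hg0 by exact Hl. rewrite Cmod_0, Rmult_0_l. nra.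
      + apply Rmult_le_compat; [apply Cmod_ge_0|left; apply exp_pos|now apply HMy|].
        eapply Rle_trans; [|exact HEN]. apply exp_le_compat. rewrite Hy.
        set (s := - (2 * eta) + t) in *. assert (Hs : s <= 0) by (unfold s; lra).
        assert (s * s <= L * L) by nra.
        assert (s * s - eta * eta <= -1) by (unfold eta; nra). nra. }
  assert (Hb : Rabs (hint f (- (2 * eta)) (- eta) (2 * eta)) <= 2 * eta * (M * E)).
  { apply Hhor; [ring|]. intros t Ht. eapply Rle_trans; [now apply HM1|unfold M; lra]. }
  assert (Ht : Rabs (hint f (- (2 * eta)) eta (2 * eta)) <= 2 * eta * (M * E)).
  { apply Hhor; [ring|]. intros t Ht. eapply Rle_trans; [now apply HM2|unfold M; lra]. }
  (* The middle segment of length [d], at distance at most [d / 2] from the centre, supplies the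
     main term. Elsewhere the integrand is positive (within [d]) or at least [- M * E] (beyond
     [d]). *)
  assert (Hr : (d * (c * exp (- (N * d ^ 2 / 4))) - 2 * eta * (M * E)
               <= vint f 0 (- eta) (2 * eta))).
  { replace d with ((eta + d / 2) - (eta - d / 2)) at 1 by field.
    replace (2 * eta) with (2 * eta - 0) at 1 by ring.
    unfold vint. apply RInt_bump_ge; try lra; try nra.
    - apply ex_RInt_vertical; [lra|]. intros t Ht'; apply Hf. unfold Re; simpl; lra.
    - intros t Ht'. rewrite Hfim.
      destruct (Rle_dec (Rabs (- eta + t)) d) as [Hl|Hl].
      + specialize (Hnear _ Hl). pose proof (exp_pos (- (N * ((- eta + t) * (- eta + t))))). nra.
      + assert (d * d < (- eta + t) * (- eta + t)).
        { rewrite <- (Rabs_pos_eq ((- eta + t) * (- eta + t))) by apply (Rle_0_sqr (- eta + t)).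
          rewrite Rabs_mult. apply Rnot_le_lt in Hl; apply Rmult_le_0_lt_compat; lra. }
        assert (exp (- (N * ((- eta + t) * (- eta + t)))) <= E) by (apply exp_le_compat; nra).
        pose proof (exp_pos (- (N * ((- eta + t) * (- eta + t))))).
        pose proof (re_le_Cmod (g (0, - eta + t))) as Hre.
        specialize (HM3 t Ht').
        assert (- M <= Re (g (0, - eta + t)))
          by (pose proof (proj1 (Rabs_le_between _ _) Hre); unfold M; lra).
        nra.
    - intros t Ht'. rewrite Hfim. apply Rmult_le_compat; try lra.
      + left; apply exp_pos.
      + apply Hnear, Rabs_le. lra.
      + apply exp_le_compat. assert ((- eta + t) * (- eta + t) <= d ^ 2 / 4) by nra. nra. }
  apply Rabs_le_between in Hb. apply Rabs_le_between in Ht.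
  assert (Hfin : d * c * exp (- (N * d ^ 2 / 4)) <= 6 * eta * M * E) by nra.
  assert (HEE : exp (- (N * d ^ 2 / 4)) = E * exp (3 * N * d ^ 2 / 4)).
  { unfold E. rewrite <- exp_plus. f_equal. field. }
  rewrite HEE in Hfin.
  assert (Hfin2 : d * c * exp (3 * N * d ^ 2 / 4) <= 6 * eta * M).
  { apply Rmult_le_reg_r with E; [exact HE|]. lra. }
  pose proof (exp_ineq1_le (3 * N * d ^ 2 / 4)).
  assert (Hk : d * c * (3 * N * d ^ 2 / 4) = 6 * eta * M).
  { unfold N. field. lra. }
  assert (0 < d * c) by nra. nra.
Qed.

Lemma disc_vanish (f : C -> C) (p : C) (r sigma : R) : 0 < sigma ->
  (forall z, Cmod (z - p)%C < r -> ex_derive f z) ->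
  (forall z, Cmod (z - p)%C < sigma -> f z = 0%C) ->
  forall z, Cmod (z - p)%C < r -> f z = 0%C.
Proof.
  intros Hs Hf H0 z Hz.
  (* The centre is the only point of the disc not of the form [p + Cexpc v]. *)
  destruct (Ceq_dec z p) as [->|Hzp].
  { apply H0. assert (E : (p - p = 0)%C) by ring. now rewrite E, Cmod_0. }
  assert (Hzp' : (z - p)%C <> 0%C).
  { intros E. apply Hzp. replace z with (z - p + p)%C by ring. rewrite E. ring. }
  pose proof (proj1 (Cmod_gt_0 _) Hzp') as Hpos.
  replace z with (p + Cexpc (Clogp (z - p)))%C by (rewrite Cexpc_Clogp by exact Hzp'; ring).
  apply (halfplane_vanish (fun v => f (p + Cexpc v)%C) (ln r) (ln sigma)).
  - intros u Hu. apply (ex_derive_C_comp f (fun v => p + Cexpc v)%C).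
    + apply Hf. assert (Eu : (p + Cexpc u - p)%C = Cexpc u) by ring. rewrite Eu, Cmod_Cexpc.
      rewrite <- (exp_ln r) by lra. now apply exp_increasing.
    + apply ex_derive_C_plus; [apply ex_derive_C_const|apply ex_derive_Cexpc].
  - intros u Hu. apply H0. assert (Eu : (p + Cexpc u - p)%C = Cexpc u) by ring.
    rewrite Eu, Cmod_Cexpc, <- (exp_ln sigma) by lra. now apply exp_increasing.
  - now apply ln_increasing.
Qed.

(** * Sums of powers and absolutely convergent power series *)

Lemma Rpower_neg_anti (x y b : R) : 0 < x -> x <= y -> 0 <= b -> Rpower y (- b) <= Rpower x (- b).
Proof.
  intros Hx Hxy Hb. unfold Rpower. apply exp_le_compat.
  assert (ln x <= ln y) by (apply ln_le; assumption). nra.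
Qed.

(** One step of the integral test: the right-hand side is the integral of [t^(-b)] from [x] to [y],
    handled through the mean value theorem for its primitive. *)
Lemma Rpower_gap (b x y : R) : 1 < b -> 0 < x -> x < y ->
  (y - x) * Rpower y (- b) <= (Rpower x (1 - b) - Rpower y (1 - b)) / (b - 1).
Proof.
  intros Hb Hx Hxy.
  destruct (MVT_cor2 (fun t => Rpower t (1 - b)) (fun t => (1 - b) * Rpower t (1 - b - 1)) x y Hxy)
    as [c [Hc1 Hc2]].
  { intros c Hc. apply derivable_pt_lim_power. lra. }
  replace (1 - b - 1) with (- b) in Hc1 by ring.
  replace (Rpower x (1 - b) - Rpower y (1 - b)) with ((b - 1) * ((y - x) * Rpower c (- b))) by lra.
  replace ((b - 1) * ((y - x) * Rpower c (- b)) / (b - 1)) with ((y - x) * Rpower c (- b)) by (field; lra).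
  apply Rmult_le_compat_l; [lra|]. apply Rpower_neg_anti; lra.
Qed.

(** [Rpower_gap] telescopes over the mesh. The term [k = 0] has no mesh interval on its left and is
    kept apart. *)
Lemma sum_Rpower_up (b x t : R) (n : nat) : 1 < b -> 0 < x -> 0 < t ->
  t * sum_n (fun k => Rpower (x + INR k * t) (- b)) n
    <= t * Rpower x (- b) + (Rpower x (1 - b) - Rpower (x + INR n * t) (1 - b)) / (b - 1).
Proof.
  intros Hb Hx Ht. induction n as [|n IH].
  - rewrite sum_O. simpl. rewrite Rmult_0_l, Rplus_0_r. unfold Rminus, Rdiv.
    rewrite Rplus_opp_r, Rmult_0_l. lra.
  - rewrite sum_Sn. change plus with Rplus.
    pose proof (pos_INR n).
    pose proof (Rpower_gap b (x + INR n * t) (x + INR (S n) * t)) as G.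
    rewrite S_INR in *.
    specialize (G Hb ltac:(nra) ltac:(nra)).
    replace (x + (INR n + 1) * t - (x + INR n * t)) with t in G by ring.
    unfold Rdiv in *. nra.
Qed.

(** The mesh is run from its far end towards [x]. As [n < N], every term has a mesh interval on its
    left, so no isolated term remains. *)
Lemma sum_Rpower_down (b x t : R) (N n : nat) : 1 < b -> 0 < x -> 0 < t -> (n < N)%nat ->
  t * sum_n (fun k => Rpower (x + (INR N - INR k) * t) (- b)) n
    <= Rpower (x + (INR N - INR (S n)) * t) (1 - b) / (b - 1).
Proof.
  intros Hb Hx Ht.
  assert (G : forall n, (n < N)%nat -> t * Rpower (x + (INR N - INR n) * t) (- b) <=
    (Rpower (x + (INR N - INR (S n)) * t) (1 - b) - Rpower (x + (INR N - INR n) * t) (1 - b)) / (b - 1)).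
  { intros k Hk. pose proof (le_INR (S k) N Hk) as Hk'.
    pose proof (Rpower_gap b (x + (INR N - INR (S k)) * t) (x + (INR N - INR k) * t)) as G.
    rewrite S_INR in *.
    specialize (G Hb ltac:(nra) ltac:(nra)).
    replace (x + (INR N - INR k) * t - (x + (INR N - (INR k + 1)) * t)) with t in G by ring.
    exact G. }
  assert (P : forall y, 0 < Rpower y (1 - b)) by (intros; apply exp_pos).
  assert (Hi : 0 < / (b - 1)) by (apply Rinv_0_lt_compat; lra).
  induction n as [|n IH]; intros Hn.
  - rewrite sum_O. eapply Rle_trans; [apply G, Hn|]. unfold Rdiv.
    pose proof (P (x + (INR N - INR 0) * t)). nra.
  - rewrite sum_Sn. change plus with Rplus. specialize (IH ltac:(lia)). specialize (G _ Hn).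
    unfold Rdiv in *. nra.
Qed.

Lemma ex_series_Rpower (b : R) : 1 < b -> ex_series (fun n => Rpower (INR (S n)) (- b)).
Proof.
  intros Hb.
  destruct (ex_finite_lim_seq_incr (sum_n (fun n => Rpower (INR (S n)) (- b))) (1 + 1 / (b - 1)))
    as [l Hl].
  - intros n. rewrite sum_Sn. change plus with Rplus.
    pose proof (exp_pos (- b * ln (INR (S (S n))))). unfold Rpower at 3. lra.
  - intros n. pose proof (sum_Rpower_up b 1 1 n Hb ltac:(lra) ltac:(lra)) as H.
    rewrite (sum_n_ext _ (fun k => Rpower (1 + INR k * 1) (- b)))
      by (intros k; f_equal; rewrite S_INR; ring).
    unfold Rpower at 2 3 in H. rewrite ln_1, !Rmult_0_r, exp_0 in H.
    pose proof (exp_pos ((1 - b) * ln (1 + INR n * 1))). unfold Rpower at 2 in H.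
    assert (Hi : 0 < / (b - 1)) by (apply Rinv_0_lt_compat; lra).
    unfold Rdiv in *. nra.
  - exists l. exact Hl.
Qed.

Lemma Cmod_sum_n (u : nat -> C) (n : nat) : Cmod (sum_n u n) <= sum_n (fun k => Cmod (u k)) n.
Proof.
  induction n as [|n IH]; [rewrite !sum_O; lra|].
  rewrite !sum_Sn. change (Cmod (sum_n u n + u (S n))%C <= sum_n (fun k => Cmod (u k)) n + Cmod (u (S n))).
  eapply Rle_trans; [apply Cmod_triangle|]. lra.
Qed.

Lemma is_series_C_eps (a : nat -> C) (l : C) : is_series a l ->
  forall eps, 0 < eps -> exists N, forall n, (N <= n)%nat -> Cmod (sum_n a n - l)%C < eps.
Proof.
  intros H eps He.
  pose proof (proj1 (filterlim_locally_ball_norm (U := C_NormedModule) (sum_n a) l) H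
    (mkposreal eps He)) as [N HN].
  exists N. intros n Hn. exact (HN n Hn).
Qed.

(* Coefficients at the radius [rho] are dominated by a geometric series, since the terms
   at a slightly larger radius tend to [0]. *)
Lemma ex_series_abs_coef (b : nat -> C) (h : C -> C) (rho : R) : 0 < rho < 1 ->
  (forall u, Cmod u < 1 -> is_pseries b u (h u)) ->
  ex_series (fun i => Cmod (b i) * rho ^ i).
Proof.
  intros Hr H.
  set (r' := (1 + rho) / 2).
  assert (Hr' : rho < r' < 1) by (unfold r'; lra).
  specialize (H (RtoC r')). rewrite Cmod_R, Rabs_pos_eq in H by lra. specialize (H ltac:(lra)).
  unfold is_pseries in H.
  destruct (is_series_C_eps _ _ H 1 Rlt_0_1) as [N HN].
  (* A term is the difference of two consecutive partial sums, both within 1 of the limit. *)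
  assert (Hb : forall i, (N <= i)%nat -> Cmod (b (S i)) * r' ^ (S i) <= 2).
  { intros i Hi. pose proof (HN i Hi) as H1. pose proof (HN (S i) ltac:(lia)) as H2.
    rewrite sum_Sn in H2.
    set (s := sum_n _ i) in *. set (l := h r') in *.
    change (plus s (scal (pow_n (RtoC r') (S i)) (b (S i))))
      with (s + pow_n (RtoC r') (S i) * b (S i))%C in H2.
    rewrite pow_n_Cpow in H2.
    replace (Cmod (b (S i)) * r' ^ S i) with (Cmod (RtoC r' ^ S i * b (S i))%C).
    2:{ rewrite Cmod_mult, Cmod_pow, Cmod_R, Rabs_pos_eq by lra. ring. }
    replace (RtoC r' ^ S i * b (S i))%C with ((s + RtoC r' ^ S i * b (S i) - l) - (s - l))%C by ring.
    eapply Rle_trans; [apply Cmod_triangle|]. rewrite Cmod_opp. lra. }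
  assert (Hq : Rabs (rho / r') < 1).
  { rewrite Rabs_pos_eq; [apply Rlt_div_l; lra|]. apply Rlt_le, Rdiv_lt_0_compat; lra. }
  apply (ex_series_incr_n _ (S N)).
  apply (ex_series_le (V := R_CompleteNormedModule) _ (fun k => 2 * (rho / r') ^ k)).
  - intros k. change (norm (Cmod (b (S N + k)%nat) * rho ^ (S N + k)))
      with (Rabs (Cmod (b (S N + k)%nat) * rho ^ (S N + k))).
    rewrite Rabs_pos_eq by (apply Rmult_le_pos; [apply Cmod_ge_0|apply pow_le; lra]).
    specialize (Hb (N + k)%nat ltac:(lia)). change (S (N + k)) with (S N + k)%nat in Hb.
    assert (E : rho ^ (S N + k) = r' ^ (S N + k) * (rho / r') ^ (S N + k)).
    { rewrite <- Rpow_mult_distr. f_equal. field. lra. }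
    rewrite E, <- Rmult_assoc.
    assert (Hp : 0 <= rho / r' <= 1).
    { split; [apply Rlt_le, Rdiv_lt_0_compat; lra|]. apply Rle_div_l; lra. }
    rewrite (pow_add (rho / r')).
    pose proof (pow_le (rho / r') k (proj1 Hp)).
    pose proof (pow_le (rho / r') (S N) (proj1 Hp)).
    assert ((rho / r') ^ S N <= 1) by (rewrite <- (pow1 (S N)); apply pow_incr; exact Hp).
    assert ((rho / r') ^ S N * (rho / r') ^ k <= (rho / r') ^ k) by nra.
    assert (0 <= Cmod (b (S N + k)%nat) * r' ^ (S N + k))
      by (apply Rmult_le_pos; [apply Cmod_ge_0|apply pow_le; lra]).
    apply Rle_trans with (2 * ((rho / r') ^ S N * (rho / r') ^ k)); [|lra].
    apply Rmult_le_compat_r; [nra|exact Hb].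
  - apply (ex_series_scal (V := R_NormedModule) 2 (fun k => (rho / r') ^ k)).
    now apply ex_series_geom.
Qed.

(** The remainder is dominated by that of the majorant series, which depends on [u] only through
    [Cmod u]: the truncation error is uniform on the circle. *)
Lemma pseries_tail (b : nat -> C) (h : C -> C) (rho S : R) : 0 < rho < 1 ->
  (forall u, Cmod u < 1 -> is_pseries b u (h u)) ->
  is_series (fun i => Cmod (b i) * rho ^ i) S ->
  forall n u, Cmod u = rho ->
    Cmod (h u - sum_n (fun i => u ^ i * b i)%C n)%C <= S - sum_n (fun i => Cmod (b i) * rho ^ i) n.
Proof.
  intros Hr Hh HS n u Hu.
  set (A := sum_n (fun i => Cmod (b i) * rho ^ i)).
  set (P := sum_n (fun i => u ^ i * b i)%C).
  assert (Hterm : forall i, 0 <= Cmod (b i) * rho ^ i)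
    by (intros; apply Rmult_le_pos; [apply Cmod_ge_0|apply pow_le; lra]).
  assert (AS : forall m, A (Datatypes.S m) = A m + Cmod (b (Datatypes.S m)) * rho ^ Datatypes.S m)
    by (intros; apply (sum_Sn (G := R_AbelianMonoid))).
  assert (PS : forall m, P (Datatypes.S m) = (P m + u ^ Datatypes.S m * b (Datatypes.S m))%C)
    by (intros; apply (sum_Sn (G := C_AbelianMonoid))).
  assert (HA : forall m, A m <= S).
  { intros m. apply (is_lim_seq_incr_compare A S HS). intros k.
    rewrite AS. pose proof (Hterm (Datatypes.S k)). lra. }
  assert (Hdiff : forall k, Cmod (P (n + k)%nat - P n)%C <= A (n + k)%nat - A n).
  { induction k as [|k IH].
    - rewrite Nat.add_0_r. replace (P n - P n)%C with (RtoC 0) by ring. rewrite Cmod_0. lra.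
    - rewrite Nat.add_succ_r, PS, AS. set (i := Datatypes.S (n + k)) in *.
      replace (P (n + k)%nat + u ^ i * b i - P n)%C
        with ((P (n + k)%nat - P n) + u ^ i * b i)%C by ring.
      eapply Rle_trans; [apply Cmod_triangle|].
      rewrite Cmod_mult, Cmod_pow, Hu. lra. }
  specialize (Hh u ltac:(lra)). unfold is_pseries in Hh.
  apply le_epsilon. intros eps He.
  destruct (is_series_C_eps _ _ Hh eps He) as [N HN].
  specialize (HN (n + N)%nat ltac:(lia)).
  rewrite (sum_n_ext _ (fun i => u ^ i * b i)%C) in HN
    by (intros i; rewrite pow_n_Cpow; reflexivity).
  fold P in HN. specialize (Hdiff N). specialize (HA (n + N)%nat).
  fold P. fold A.
  replace (h u - P n)%C with ((P (n + N)%nat - P n) - (P (n + N)%nat - h u))%C by ring.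
  eapply Rle_trans; [apply Cmod_triangle|]. rewrite Cmod_opp. lra.
Qed.

(** * Roots of unity and coefficient estimates *)

(** Equalities produced by the algebraic hierarchy may be typed at a carrier merely convertible to
    [C]; the [change] restores the type on which [ring] is declared. *)
Ltac Cring := match goal with |- @eq _ ?x ?y => change (@eq C x y) end; ring.

Lemma sum_n_C_S (u : nat -> C) (n : nat) : sum_n u (S n) = (sum_n u n + u (S n))%C :> C.
Proof. apply (sum_Sn (G := C_AbelianMonoid)). Qed.

Lemma sum_n_C_0 (u : nat -> C) : sum_n u 0 = u 0%nat :> C.
Proof. apply (sum_O (G := C_AbelianMonoid)). Qed.

Lemma sum_n_C_scal (c : C) (u : nat -> C) (n : nat) :
  sum_n (fun k => c * u k)%C n = (c * sum_n u n)%C :> C.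
Proof. apply (sum_n_mult_l (K := C_Ring)). Qed.

Lemma sum_n_C_zero (u : nat -> C) (n : nat) :
  (forall k, (k <= n)%nat -> u k = RtoC 0) -> sum_n u n = RtoC 0 :> C.
Proof.
  intros H. induction n as [|n IH]; [rewrite sum_n_C_0; apply H; lia|].
  rewrite sum_n_C_S, IH, (H (S n)) by (intros; try apply H; lia). ring.
Qed.

Lemma sum_n_C_single (u : nat -> C) (n p : nat) : (p <= n)%nat ->
  (forall k, (k <= n)%nat -> k <> p -> u k = RtoC 0) -> sum_n u n = u p :> C.
Proof.
  intros Hp H. induction n as [|n IH].
  - replace p with 0%nat by lia. apply sum_n_C_0.
  - rewrite sum_n_C_S. destruct (Nat.eq_dec p (S n)) as [->|E].
    + rewrite sum_n_C_zero by (intros; apply H; lia). ring.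
    + rewrite IH, (H (S n)) by (intros; try apply H; lia). ring.
Qed.

Lemma sum_n_C_const (c : C) (n : nat) : sum_n (fun _ => c) n = (RtoC (INR (S n)) * c)%C :> C.
Proof.
  induction n as [|n IH]; [rewrite sum_n_C_0; simpl; ring|].
  rewrite sum_n_C_S, IH, (S_INR (S n)), RtoC_plus. ring.
Qed.

Definition rootu (N : nat) : C := Cexpc (0, 2 * PI / INR N).

Lemma Cmod_rootu (N : nat) : Cmod (rootu N) = 1.
Proof. unfold rootu. rewrite Cmod_Cexpc. apply exp_0. Qed.

Lemma Cmod_rootu_pow (N k : nat) : Cmod (rootu N ^ k)%C = 1.
Proof. rewrite Cmod_pow, Cmod_rootu. apply pow1. Qed.

Lemma rootu_pow (N k : nat) : (rootu N ^ k)%C = Cexpc (0, 2 * PI * (INR k / INR N)).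
Proof.
  unfold rootu. rewrite Cexpc_pow. f_equal. unfold Cmult; simpl. f_equal; unfold Rdiv; ring.
Qed.

Lemma rootu_pow_N (N : nat) : (0 < N)%nat -> (rootu N ^ N = 1)%C.
Proof.
  intros HN. rewrite rootu_pow. unfold Rdiv. rewrite Rinv_r, Rmult_1_r by (apply not_0_INR; lia).
  unfold Cexpc; simpl. rewrite exp_0, cos_2PI, sin_2PI. unfold RtoC. f_equal; ring.
Qed.

Lemma Re_rootu_pow (N k : nat) :
  Re (rootu N ^ k)%C = 1 - 2 * (sin (PI * (INR k / INR N)))².
Proof.
  rewrite rootu_pow. unfold Cexpc, Re, Im; simpl. rewrite exp_0.
  rewrite (Rmult_assoc 2), cos_2a_sin. unfold Rsqr. ring.
Qed.

Lemma rootu_pow_neq_1 (N p : nat) : (0 < p < N)%nat -> (rootu N ^ p)%C <> RtoC 1.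
Proof.
  intros Hp E. pose proof (Re_rootu_pow N p) as H. rewrite E in H. simpl in H.
  assert (H0 : sin (PI * (INR p / INR N)) = 0) by (apply Rsqr_0_uniq; lra).
  assert (Hq : 0 < INR p / INR N < 1).
  { assert (0 < INR p) by (apply lt_0_INR; lia). assert (INR p < INR N) by (apply lt_INR; lia).
    split; [apply Rdiv_lt_0_compat; lra|]. apply Rlt_div_l; lra. }
  pose proof PI_RGT_0.
  assert (0 < sin (PI * (INR p / INR N))) by (apply sin_gt_0; nra). lra.
Qed.

Lemma Cpow_mod_root (N p : nat) : (0 < N)%nat -> (rootu N ^ p = rootu N ^ (p mod N))%C.
Proof.
  intros HN. rewrite (Nat.div_mod_eq p N) at 1.
  rewrite Cpow_add_r, Cpow_mult_r, rootu_pow_N, Cpow_1_l by exact HN. ring.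
Qed.

Lemma geom_sum_C (q : C) (n : nat) : ((q - 1) * sum_n (fun k => q ^ k) n = q ^ S n - 1)%C.
Proof.
  induction n as [|n IH]; [rewrite sum_n_C_0; simpl; ring|].
  rewrite sum_n_C_S, Cmult_plus_distr_l, IH. simpl. ring.
Qed.

Lemma rootu_orthogonality (n p : nat) :
  sum_n (fun k => (rootu (S n) ^ k) ^ p)%C n =
  (if Nat.eqb (p mod S n) 0 then RtoC (INR (S n)) else RtoC 0) :> C.
Proof.
  rewrite (sum_n_ext _ (fun k => (rootu (S n) ^ p) ^ k)%C)
    by (intros k; rewrite <- !Cpow_mult_r; f_equal; lia).
  rewrite (Cpow_mod_root (S n) p) by lia.
  destruct (Nat.eqb_spec (p mod S n) 0) as [E|E].
  - rewrite E. rewrite (sum_n_ext _ (fun _ => RtoC 1)) by (intros k; apply Cpow_1_l).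
    rewrite sum_n_C_const. ring.
  - pose proof (Nat.mod_upper_bound p (S n) ltac:(lia)) as Hlt.
    set (r := (p mod S n)%nat) in *.
    pose proof (geom_sum_C (rootu (S n) ^ r) n) as G.
    rewrite <- Cpow_mult_r, (Nat.mul_comm r), Cpow_mult_r, rootu_pow_N, Cpow_1_l in G by lia.
    replace (1 - 1)%C with (RtoC 0) in G by ring.
    destruct (Ceq_dec (sum_n (fun k => (rootu (S n) ^ r) ^ k)%C n) 0%C) as [H0|H0]; [exact H0|exfalso].
    destruct (Ceq_dec (rootu (S n) ^ r - 1)%C 0%C) as [H|H]; [|now apply (Cmult_neq_0 _ _ H H0)].
    apply (rootu_pow_neq_1 (S n) r ltac:(lia)).
    replace (rootu (S n) ^ r)%C with ((rootu (S n) ^ r - 1) + 1)%C by ring. rewrite H. ring.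
Qed.

Lemma sum_n_le_loc (u v : nat -> R) (n : nat) :
  (forall k, (k <= n)%nat -> u k <= v k) -> sum_n u n <= sum_n v n.
Proof.
  intros H. induction n as [|n IH]; [rewrite !sum_O; apply H; lia|].
  rewrite !sum_Sn. change plus with Rplus.
  apply Rplus_le_compat; [apply IH; intros; apply H; lia|apply H; lia].
Qed.

(** A discrete Fourier coefficient at the [N = S N'] points [rho * om^k], with [om^(-kn)] written as
    [(om^k)^(N-n)]. The partial sum up to [N'] contains one exponent of each residue modulo [N], so
    only [b n] survives; replacing the partial sum by [h] costs the majorant tail at each point. *)
Lemma coef_average (b : nat -> C) (h : C -> C) (rho S0 : R) (n N' : nat) : 0 < rho < 1 ->
  (forall u, Cmod u < 1 -> is_pseries b u (h u)) ->
  is_series (fun i => Cmod (b i) * rho ^ i) S0 -> (n <= N')%nat ->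
  INR (S N') * (Cmod (b n) * rho ^ n) <=
    sum_n (fun k => Cmod (h (RtoC rho * rootu (S N') ^ k)%C)) N'
    + INR (S N') * (S0 - sum_n (fun i => Cmod (b i) * rho ^ i) N').
Proof.
  intros Hr Hh HS Hn. set (N := S N'). set (om := rootu N).
  set (P := fun u => sum_n (fun i => u ^ i * b i)%C N').
  set (T := S0 - sum_n (fun i => Cmod (b i) * rho ^ i) N').
  assert (Hu : forall k, Cmod (RtoC rho * om ^ k)%C = rho).
  { intros k. unfold om. rewrite Cmod_mult, Cmod_rootu_pow, Cmod_R, Rabs_pos_eq by lra. ring. }
  assert (E : sum_n (fun k => P (RtoC rho * om ^ k) * (om ^ k) ^ (N - n))%C N'
              = (RtoC (INR N) * (RtoC rho ^ n * b n))%C :> C).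
  { unfold P.
    rewrite (sum_n_ext _ (fun k => sum_n (fun i => RtoC rho ^ i * b i * (om ^ k) ^ (i + (N - n)))%C N')).
    2:{ intros k. rewrite Cmult_comm, <- sum_n_C_scal. apply sum_n_ext. intros i.
        rewrite Cpow_mult_l, Cpow_add_r. Cring. }
    rewrite sum_n_switch.
    rewrite (sum_n_C_single _ N' n Hn).
    - rewrite sum_n_C_scal. unfold om, N. rewrite rootu_orthogonality.
      replace (n + (S N' - n))%nat with (S N') by lia.
      rewrite Nat.Div0.mod_same. simpl Nat.eqb. cbv iota. Cring.
    - intros i Hi Hin. rewrite sum_n_C_scal. unfold om, N. rewrite rootu_orthogonality.
      destruct (Nat.eqb_spec ((i + (S N' - n)) mod S N') 0) as [Z|Z]; [exfalso|Cring].
      apply Nat.Div0.div_exact in Z.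
      set (q := ((i + (S N' - n)) / S N')%nat) in *.
      (* The exponent [i + (N - n)] lies strictly between 0 and [2 N], so a multiple of [N] can only
         be [N] itself, that is [i = n]. *)
      destruct q as [|[|q]]; nia. }
  assert (Hb : INR N * (Cmod (b n) * rho ^ n) = Cmod (RtoC (INR N) * (RtoC rho ^ n * b n))%C).
  { rewrite !Cmod_mult, Cmod_pow, !Cmod_R, !Rabs_pos_eq; [ring|lra|apply pos_INR]. }
  rewrite Hb, <- E. eapply Rle_trans; [apply Cmod_sum_n|].
  assert (HT : forall k, Cmod (P (RtoC rho * om ^ k) * (om ^ k) ^ (N - n))%C <=
                         Cmod (h (RtoC rho * om ^ k)%C) + T).
  { intros k. rewrite Cmod_mult, Cmod_pow. unfold om at 2. rewrite Cmod_rootu_pow, pow1, Rmult_1_r.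
    pose proof (pseries_tail b h rho S0 Hr Hh HS N' _ (Hu k)) as Ht.
    fold (P (RtoC rho * om ^ k)%C) in Ht. fold T in Ht.
    pose proof (Cmod_triangle_inv (P (RtoC rho * om ^ k)%C) (h (RtoC rho * om ^ k)%C)) as H1.
    rewrite <- (Cmod_opp (P (RtoC rho * om ^ k)%C - _)%C) in H1.
    replace (- (P (RtoC rho * om ^ k) - h (RtoC rho * om ^ k)))%C
      with (h (RtoC rho * om ^ k) - P (RtoC rho * om ^ k))%C in H1 by ring.
    lra. }
  replace (INR N * T) with (sum_n (fun _ => T) N') by (rewrite sum_n_const; reflexivity).
  eapply Rle_trans; [|right; apply (sum_n_plus (G := R_AbelianMonoid))].
  apply sum_n_le_loc. intros k _. apply HT.
Qed.

(** * Distances to 1 on the circle and the growth of the coefficients *)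

Lemma sin_ge_third (x : R) : 0 <= x <= PI / 2 -> x / 3 <= sin x.
Proof.
  intros [H0 H1]. pose proof PI_4. pose proof PI_RGT_0.
  destruct (sin_bound x 0 H0 ltac:(lra)) as [Hs _].
  unfold sin_approx, sin_term in Hs. simpl in Hs. nra.
Qed.

Lemma sin_PI_mult_ge (t : R) : 0 <= t <= 1 / 2 -> t <= sin (PI * t).
Proof.
  intros Ht. pose proof PI2_3_2. pose proof (sin_ge_third (PI * t)) as H0.
  assert (0 <= PI * t <= PI / 2) by nra. specialize (H0 H1). nra.
Qed.

(** With [tau = k / N], the squared distance is [(1 - rho)^2 + 4 rho sin(pi tau)^2], and
    [sin(pi tau)] is at least the distance from [tau] to the nearer of 0 and 1. The two alternatives
    are the two arcs leaving 1, matched later by the upward and downward sums of powers. *)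
Lemma Cmod_1_minus_rootu (N k : nat) (rho : R) : 1 / 2 <= rho < 1 -> (k <= N)%nat -> (0 < N)%nat ->
  1 - rho + INR k * / INR N <= 2 * Cmod (1 - RtoC rho * rootu N ^ k)%C \/
  1 - rho + (INR N - INR k) * / INR N <= 2 * Cmod (1 - RtoC rho * rootu N ^ k)%C.
Proof.
  intros Hr Hk HN.
  assert (PN : 0 < INR N) by (apply lt_0_INR; lia).
  set (tau := INR k * / INR N).
  assert (Ht : 0 <= tau <= 1).
  { pose proof (pos_INR k). pose proof (le_INR _ _ Hk). unfold tau. split.
    - apply Rmult_le_pos; [lra|]. left; now apply Rinv_0_lt_compat.
    - apply Rle_div_l; lra. }
  replace ((INR N - INR k) * / INR N) with (1 - tau) by (unfold tau; field; lra).
  set (c := Cmod (1 - RtoC rho * rootu N ^ k)%C).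
  assert (Hc : c ^ 2 = (1 - rho) ^ 2 + 4 * rho * (sin (PI * tau)) ^ 2).
  { unfold c. rewrite Cmod2_alt.
    pose proof (Re_rootu_pow N k) as HRe. pose proof (Cmod_rootu_pow N k) as Hm.
    assert (Hm2 : Cmod (rootu N ^ k)%C ^ 2 = 1) by (rewrite Hm; ring).
    rewrite Cmod2_alt in Hm2. unfold Rdiv in HRe. fold tau in HRe. unfold Rsqr in HRe.
    destruct (rootu N ^ k)%C as [a b]. unfold Re, Im in *; simpl in *. nra. }
  assert (Hc0 : 0 <= c) by apply Cmod_ge_0.
  destruct (Rle_dec tau (1 / 2)) as [H|H].
  - left. pose proof (sin_PI_mult_ge tau ltac:(lra)).
    assert (tau ^ 2 <= sin (PI * tau) ^ 2) by nra.
    apply Rsqr_incr_0_var; [|lra]. unfold Rsqr.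
    set (s2 := sin (PI * tau) ^ 2) in *. assert (0 <= s2) by apply pow2_ge_0.
    assert (2 * s2 <= 4 * rho * s2) by nra.
    nra.
  - right. pose proof (sin_PI_mult_ge (1 - tau) ltac:(lra)) as Hs.
    replace (PI * (1 - tau)) with (PI - PI * tau) in Hs by ring. rewrite sin_PI_x in Hs.
    assert ((1 - tau) ^ 2 <= sin (PI * tau) ^ 2) by nra.
    apply Rsqr_incr_0_var; [|lra]. unfold Rsqr.
    set (s2 := sin (PI * tau) ^ 2) in *. assert (0 <= s2) by apply pow2_ge_0.
    assert (2 * s2 <= 4 * rho * s2) by nra.
    nra.
Qed.

Lemma Rpower_double (c y b : R) : 0 < y -> y <= 2 * c -> 0 <= b ->
  Rpower c (- b) <= Rpower 2 b * Rpower y (- b).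
Proof.
  intros Hy Hyc Hb. eapply Rle_trans; [apply (Rpower_neg_anti (y / 2)); lra|].
  unfold Rdiv. rewrite <- Rpower_mult_distr by lra.
  replace (Rpower (/ 2) (- b)) with (Rpower 2 b); [lra|].
  unfold Rpower. rewrite ln_Rinv by lra. f_equal. ring.
Qed.

Lemma exp_pow_INR (x : R) (n : nat) : exp x ^ n = exp (INR n * x).
Proof.
  induction n as [|n IH]; [simpl; now rewrite Rmult_0_l, exp_0|].
  rewrite S_INR, Rmult_plus_distr_r, exp_plus, Rmult_1_l, <- IH. simpl. ring.
Qed.

(** The reciprocal is [(1 + 1/(n+1))^n], below [exp 1 <= 3]. The shift by 2 keeps the radius at
    least [1/2] even for [n = 0]. *)
Lemma inv_pow_bound (n : nat) : 1 <= 3 * (1 - / (INR n + 2)) ^ n.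
Proof.
  pose proof (pos_INR n).
  set (q := 1 + / (INR n + 1)).
  assert (Hq : 0 < q) by (unfold q; pose proof (Rinv_0_lt_compat (INR n + 1)); lra).
  replace (1 - / (INR n + 2)) with (/ q) by (unfold q; field; lra).
  assert (Hp : q ^ n <= 3).
  { apply Rle_trans with (exp (/ (INR n + 1)) ^ n).
    - apply pow_incr. split; [lra|]. apply exp_ineq1_le.
    - rewrite exp_pow_INR. eapply Rle_trans; [|apply exp_le_3]. apply exp_le_compat.
      apply Rle_div_l; lra. }
  rewrite pow_inv. assert (0 < q ^ n) by now apply pow_lt.
  apply Rmult_le_reg_r with (q ^ n); [assumption|].
  rewrite Rmult_assoc, Rinv_l; lra.
Qed.

(** With [x0 = 1/(n+2)], the averages of [|1-u|^(-beta)] are bounded by Riemann sums of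
    [(x0 + tau)^(-beta)] taken from both ends of the unit interval, hence are of order [x0^(1-beta)]
    uniformly in the number of points. That number is sent to infinity only to remove the truncation
    error [eps]. *)
Lemma coef_growth (b : nat -> C) (h : C -> C) (K beta : R) : 1 < beta -> 0 <= K ->
  (forall u, Cmod u < 1 -> is_pseries b u (h u)) ->
  (forall u, Cmod u < 1 -> Cmod (h u) <= K * Rpower (Cmod (1 - u)%C) (- beta)) ->
  forall n, Cmod (b n) <=
    3 * (K * Rpower 2 beta * (1 + 2 / (beta - 1))) * Rpower (INR n + 2) (beta - 1).
Proof.
  intros Hb HK Hh Hbound n.
  set (x0 := / (INR n + 2)). set (rho := 1 - x0).
  pose proof (pos_INR n) as Hn.
  assert (Hx0 : 0 < x0 <= 1 / 2).
  { unfold x0. split; [apply Rinv_0_lt_compat; lra|].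
    replace (1 / 2) with (/ 2) by field. apply Rinv_le_contravar; lra. }
  assert (Hr : 1 / 2 <= rho < 1) by (unfold rho; lra).
  set (K1 := K * Rpower 2 beta).
  assert (HK1 : 0 <= K1) by (apply Rmult_le_pos; [exact HK|left; apply exp_pos]).
  destruct (ex_series_abs_coef b h rho ltac:(lra) Hh) as [S0 HS].
  assert (Hi : 0 < / (beta - 1)) by (apply Rinv_0_lt_compat; lra).
  assert (Ex0 : Rpower (INR n + 2) (beta - 1) = Rpower x0 (1 - beta)).
  { unfold x0, Rpower. rewrite ln_Rinv by lra. f_equal. ring. }
  assert (Main : forall eps, 0 < eps ->
    Cmod (b n) * rho ^ n <= K1 * (1 + 2 / (beta - 1)) * Rpower x0 (1 - beta) + eps).
  { intros eps He.
    pose proof (proj1 (filterlim_locally_ball_norm (U := R_NormedModule) _ S0) HS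
      (mkposreal eps He)) as [N0 HN0].
    (* Large enough for a tail below [eps], for [n <= N'], and for the mesh [t = 1/N] to satisfy
       [t <= x0], which lets the isolated term [t * x0^(-beta)] be absorbed in [x0^(1-beta)]. *)
    set (N' := (N0 + n + 1)%nat). set (N := S N').
    specialize (HN0 N' ltac:(unfold N'; lia)).
    change (Rabs (sum_n (fun i => Cmod (b i) * rho ^ i) N' - S0) < eps) in HN0.
    apply Rabs_lt_between in HN0.
    pose proof (coef_average b h rho S0 n N' ltac:(lra) Hh HS ltac:(unfold N'; lia)) as Hav.
    fold N in Hav.
    assert (PN : 0 < INR N) by (apply lt_0_INR; unfold N; lia).
    set (t := / INR N). assert (Ht : 0 < t) by (now apply Rinv_0_lt_compat).
    assert (Htx : t <= x0).
    { unfold t, x0. apply Rinv_le_contravar; [lra|].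
      replace (INR n + 2) with (INR (n + 2)) by (rewrite plus_INR; simpl; ring).
      apply le_INR. unfold N, N'. lia. }
    assert (Hterm : forall k, (k <= N')%nat -> Cmod (h (RtoC rho * rootu N ^ k)%C) <=
      K1 * (Rpower (x0 + INR k * t) (- beta) + Rpower (x0 + (INR N - INR k) * t) (- beta))).
    { intros k Hk.
      assert (Hmod : Cmod (RtoC rho * rootu N ^ k)%C < 1).
      { rewrite Cmod_mult, Cmod_rootu_pow, Cmod_R, Rabs_pos_eq; lra. }
      eapply Rle_trans; [apply Hbound, Hmod|]. unfold K1. rewrite Rmult_assoc.
      apply Rmult_le_compat_l; [exact HK|].
      pose proof (exp_pos (- beta * ln (x0 + INR k * t))) as P1.
      pose proof (exp_pos (- beta * ln (x0 + (INR N - INR k) * t))) as P2.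
      fold (Rpower (x0 + INR k * t) (- beta)) in P1.
      fold (Rpower (x0 + (INR N - INR k) * t) (- beta)) in P2.
      pose proof (exp_pos (beta * ln 2)) as P3. fold (Rpower 2 beta) in P3.
      pose proof (pos_INR k). assert (INR k <= INR N) by (apply le_INR; unfold N; lia).
      destruct (Cmod_1_minus_rootu N k rho Hr ltac:(unfold N; lia) ltac:(unfold N; lia)) as [H1|H1];
        fold t in H1; replace (1 - rho) with x0 in H1 by (unfold rho; ring).
      - apply Rpower_double with (b := beta) in H1; [nra|nra|lra].
      - apply Rpower_double with (b := beta) in H1; [nra|nra|lra]. }
    apply sum_n_le_loc in Hterm.
    rewrite (sum_n_mult_l (K := R_Ring)), (sum_n_plus (G := R_AbelianMonoid)) in Hterm.
    change (mult K1) with (Rmult K1) in Hterm. change plus with Rplus in Hterm.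
    set (U := sum_n (fun k => Rpower (x0 + INR k * t) (- beta)) N') in *.
    set (D := sum_n (fun k => Rpower (x0 + (INR N - INR k) * t) (- beta)) N') in *.
    (* The upward sum gives [1 + 1/(beta-1)] and the downward one [1/(beta-1)], whence the factor
       [1 + 2/(beta-1)]. *)
    assert (HU : t * U <= (1 + / (beta - 1)) * Rpower x0 (1 - beta)).
    { pose proof (sum_Rpower_up beta x0 t N' Hb ltac:(lra) Ht) as HU. fold U in HU.
      pose proof (exp_pos ((1 - beta) * ln (x0 + INR N' * t))) as P1.
      fold (Rpower (x0 + INR N' * t) (1 - beta)) in P1.
      assert (E1 : x0 * Rpower x0 (- beta) = Rpower x0 (1 - beta)).
      { rewrite <- (Rpower_1 x0) at 1 by lra. rewrite <- Rpower_plus. f_equal. }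
      pose proof (exp_pos (- beta * ln x0)) as P2. fold (Rpower x0 (- beta)) in P2.
      unfold Rdiv in HU. nra. }
    assert (HD : t * D <= / (beta - 1) * Rpower x0 (1 - beta)).
    { pose proof (sum_Rpower_down beta x0 t N N' Hb ltac:(lra) Ht ltac:(unfold N; lia)) as HD.
      fold D in HD. fold N in HD. replace (x0 + (INR N - INR N) * t) with x0 in HD by ring.
      unfold Rdiv in HD. lra. }
    assert (Hfin : INR N * (Cmod (b n) * rho ^ n) <= K1 * (U + D) + INR N * eps).
    { eapply Rle_trans; [exact Hav|]. apply Rplus_le_compat; [exact Hterm|].
      apply Rmult_le_compat_l; lra. }
    apply Rmult_le_compat_l with (r := t) in Hfin; [|lra].
    replace (t * (INR N * (Cmod (b n) * rho ^ n))) with (Cmod (b n) * rho ^ n) in Hfin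
      by (unfold t; field; lra).
    replace (t * (K1 * (U + D) + INR N * eps)) with (K1 * (t * U + t * D) + eps) in Hfin
      by (unfold t; field; lra).
    unfold Rdiv. nra. }
  rewrite Ex0.
  apply le_epsilon in Main. pose proof (inv_pow_bound n) as Hip. fold x0 in Hip. fold rho in Hip.
  pose proof (Cmod_ge_0 (b n)). fold K1. nra.
Qed.

(** * The domains Delta and Omega* *)

Lemma Cmod_minus_1_sq (s : C) : Cmod (s - 1)%C ^ 2 = Cmod s ^ 2 - 2 * Re s + 1.
Proof. rewrite !Cmod2_alt. destruct s as [x y]. unfold Re, Im; simpl. ring. Qed.

Lemma D11_iff (s : C) : D11 s <-> Cmod s ^ 2 < 2 * Re s.
Proof.
  unfold D11. pose proof (Cmod_minus_1_sq s) as E. pose proof (Cmod_ge_0 (s - 1)%C).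
  split; intros H1; [nra|]. apply Rnot_le_lt. intros H2. nra.
Qed.

Lemma D11_Re_pos (s : C) : D11 s -> 0 < Re s.
Proof. rewrite D11_iff. pose proof (pow2_ge_0 (Cmod s)). lra. Qed.

Lemma Re_pos_neq_0 (s : C) : 0 < Re s -> s <> 0%C.
Proof. intros H E. rewrite E in H. unfold Re in H; simpl in H. lra. Qed.

Lemma Cargp_bound (s : C) : 0 < Re s -> - PI / 2 < Cargp s < PI / 2.
Proof. intros H. unfold Cargp. destruct (Rlt_dec 0 (Re s)) as [_|F]; [apply atan_bound|contradiction]. Qed.

Lemma Clogp_Cexpc (z : C) : - PI / 2 < Im z < PI / 2 -> Clogp (Cexpc z) = z.
Proof.
  intros Hz. unfold Clogp. rewrite Cmod_Cexpc, ln_exp.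
  assert (Hc : 0 < cos (Im z)) by (apply cos_gt_0; lra).
  pose proof (exp_pos (Re z)) as He.
  unfold Cargp. destruct (Rlt_dec 0 (Re (Cexpc z))) as [_|F].
  - unfold Cexpc; simpl.
    replace (exp (Re z) * sin (Im z) / (exp (Re z) * cos (Im z))) with (tan (Im z))
      by (unfold tan; field; lra).
    rewrite atan_tan by lra. now destruct z.
  - exfalso; apply F. unfold Cexpc; simpl. nra.
Qed.

Lemma DeltaDom_iff (xi : C) :
  DeltaDom xi <-> - PI / 2 < Im xi < PI / 2 /\ D11 (Cexpc (- xi)%C).
Proof.
  split.
  - intros [s [Hs ->]]. pose proof (D11_Re_pos s Hs) as Hp. split.
    + pose proof (Cargp_bound s Hp). unfold Im, Clogp; simpl. lra.
    + replace (- - Clogp s)%C with (Clogp s) by ring.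
      now rewrite Cexpc_Clogp by now apply Re_pos_neq_0.
  - intros [H1 H2]. exists (Cexpc (- xi)%C). split; [exact H2|].
    rewrite Clogp_Cexpc; [ring|]. unfold Im in *; simpl. lra.
Qed.

(** The polar equation of the disc, [|s| < 2 cos(arg s)], read through [s = exp(-xi)]. It displays
    the convexity from which star-shapedness follows. *)
Lemma DeltaDom_iff_cos (xi : C) :
  DeltaDom xi <-> - PI / 2 < Im xi < PI / 2 /\ exp (- Re xi) < 2 * cos (Im xi).
Proof.
  rewrite DeltaDom_iff, D11_iff, Cmod_Cexpc.
  destruct xi as [x y]. unfold Cexpc, Re, Im; simpl. rewrite cos_neg.
  pose proof (exp_pos (- x)). split; intros [H1 H2]; (split; [exact H1|]); nra.
Qed.

(** Convexity between 0 and [x], obtained by averaging the tangent inequality at [t * x] over the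
    two endpoints; [cos_chord_pos] does the same for concavity of the cosine. *)
Lemma exp_chord (x t : R) : 0 <= t <= 1 -> exp (t * x) <= 1 - t + t * exp x.
Proof.
  intros Ht.
  pose proof (exp_ineq1_le (x - t * x)) as H1. pose proof (exp_ineq1_le (- (t * x))) as H2.
  pose proof (exp_pos (t * x)) as Hp.
  assert (E1 : exp x = exp (t * x) * exp (x - t * x)) by (rewrite <- exp_plus; f_equal; ring).
  assert (E2 : 1 = exp (t * x) * exp (- (t * x))) by (rewrite <- exp_plus, <- exp_0; f_equal; ring).
  assert (F1 : exp (t * x) * (1 + (x - t * x)) <= exp x) by (rewrite E1; nra).
  assert (F2 : exp (t * x) * (1 + - (t * x)) <= 1) by (rewrite E2 at 2; nra).
  set (e := exp (t * x)) in *. nra.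
Qed.

Lemma cos_chord_pos (y t : R) : 0 <= y <= PI / 2 -> 0 <= t <= 1 -> 1 - t + t * cos y <= cos (t * y).
Proof.
  intros Hy Ht.
  assert (Ha : 0 <= t * y <= y) by nra. set (a := t * y) in *.
  assert (Hmono : forall u v, 0 <= u -> u <= v -> v <= PI / 2 -> sin u <= sin v).
  { intros u v H1 H2 H3. apply sin_incr_1; lra. }
  assert (F1 : 1 - cos a <= sin a * a).
  { destruct (Req_dec a 0) as [->|Ha0]; [rewrite cos_0; lra|].
    destruct (MVT_cor2 cos (fun x => - sin x) 0 a ltac:(lra)) as [c [E Hc]].
    { intros; apply derivable_pt_lim_cos. }
    rewrite cos_0 in E. pose proof (Hmono c a ltac:(lra) ltac:(lra) ltac:(lra)). nra. }
  assert (F2 : cos y <= cos a - sin a * (y - a)).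
  { destruct (Req_dec a y) as [->|Hay]; [lra|].
    destruct (MVT_cor2 cos (fun x => - sin x) a y ltac:(lra)) as [c [E Hc]].
    { intros; apply derivable_pt_lim_cos. }
    pose proof (Hmono a c ltac:(lra) ltac:(lra) ltac:(lra)). nra. }
  assert (E : cos a = (1 - t) * (cos a + sin a * a) + t * (cos a - sin a * (y - a)))
    by (unfold a; ring).
  nra.
Qed.

Lemma cos_chord (y t : R) : - PI / 2 < y < PI / 2 -> 0 <= t <= 1 -> 1 - t + t * cos y <= cos (t * y).
Proof.
  intros Hy Ht. destruct (Rle_dec 0 y) as [H|H]; [apply cos_chord_pos; lra|].
  rewrite <- (cos_neg y), <- (cos_neg (t * y)).
  replace (- (t * y)) with (t * - y) by ring. apply cos_chord_pos; lra.
Qed.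

(** The function [2 cos y - exp(-x)] is concave where [|y| < pi/2] and equals 1 at the origin, so
    positivity at [xi] propagates to the whole segment from 0. *)
Lemma DeltaDom_star (xi : C) (t : R) : 0 <= t <= 1 -> DeltaDom xi -> DeltaDom (RtoC t * xi)%C.
Proof.
  rewrite !DeltaDom_iff_cos. intros Ht [H1 H2].
  destruct xi as [x y]. unfold Re, Im in *; simpl in *.
  replace (t * x - 0 * y) with (t * x) by ring. replace (t * y + 0 * x) with (t * y) by ring.
  split.
  { pose proof PI_RGT_0. destruct (Rle_dec 0 y); split; nra. }
  pose proof (exp_chord (- x) t Ht) as E. pose proof (cos_chord y t H1 Ht) as F.
  replace (- (t * x)) with (t * - x) by ring.
  assert (0 < 1 - t + t * (2 * cos y - exp (- x))); [|lra].
  destruct (Req_dec t 0) as [->|H0]; [lra|].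
  assert (0 < t * (2 * cos y - exp (- x))) by (apply Rmult_lt_0_compat; lra). lra.
Qed.

Lemma DeltaDom_open (xi : C) : DeltaDom xi ->
  exists r, 0 < r /\ forall z, Cmod (z - xi)%C < r -> DeltaDom z.
Proof.
  rewrite DeltaDom_iff. intros [H1 H2]. unfold D11 in H2.
  set (e := 1 - Cmod (Cexpc (- xi) - 1)%C) in *.
  assert (He : 0 < e) by (unfold e; lra).
  destruct (ex_derive_C_continuous (fun z => Cexpc (- z)%C) xi) with (eps := e) as [d [Hd D]];
    [|exact He|].
  { apply (ex_derive_C_comp Cexpc Copp); [apply ex_derive_Cexpc|].
    apply (ex_derive_ext (fun z : C => (-1) * z)%C); [intros z; simpl; ring|apply ex_derive_C_scal]. }
  set (g := Rmin (PI / 2 - Im xi) (Im xi + PI / 2)).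
  assert (Hg : 0 < g) by (apply Rmin_pos; lra).
  assert (Hg1 : g <= PI / 2 - Im xi) by apply Rmin_l.
  assert (Hg2 : g <= Im xi + PI / 2) by apply Rmin_r.
  exists (Rmin d g). split; [now apply Rmin_pos|].
  intros z Hz. rewrite DeltaDom_iff. split.
  - assert (Hi : Cmod (z - xi)%C < g) by (eapply Rlt_le_trans; [exact Hz|apply Rmin_r]).
    pose proof (im_le_Cmod (z - xi)%C) as H.
    change (Im (z - xi)%C) with (Im z - Im xi) in H. apply Rabs_le_between in H. lra.
  - assert (Hi : Cmod (z - xi)%C < d) by (eapply Rlt_le_trans; [exact Hz|apply Rmin_l]).
    specialize (D z Hi). unfold D11.
    replace (Cexpc (- z) - 1)%C with ((Cexpc (- z) - Cexpc (- xi)) + (Cexpc (- xi) - 1))%C by ring.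
    eapply Rle_lt_trans; [apply Cmod_triangle|]. unfold e in D. lra.
Qed.

Lemma Omega_star_iff (m : nat) (w : C) : Omega_star m w <-> w <> 0%C /\ DeltaDom (w ^ m)%C.
Proof. unfold Omega_star, cov_proj. now rewrite pow_n_Cpow. Qed.

Lemma Omega_star_open (m : nat) (w : C) : Omega_star m w ->
  exists r, 0 < r /\ forall z, Cmod (z - w)%C < r -> Omega_star m z.
Proof.
  rewrite Omega_star_iff. intros [H1 H2].
  destruct (DeltaDom_open _ H2) as [e [He D]].
  destruct (ex_derive_C_continuous (fun z => z ^ m)%C w) with (eps := e) as [d [Hd Dd]];
    [apply ex_derive_C_pow, ex_derive_C_id|exact He|].
  apply Cmod_gt_0 in H1.
  exists (Rmin d (Cmod w)). split; [now apply Rmin_pos|].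
  intros z Hz. rewrite Omega_star_iff. split.
  - intros ->. assert (Cmod (0 - w)%C < Cmod w) by (eapply Rlt_le_trans; [exact Hz|apply Rmin_r]).
    replace (0 - w)%C with (- w)%C in H by ring. rewrite Cmod_opp in H. lra.
  - apply D, Dd. eapply Rlt_le_trans; [exact Hz|apply Rmin_l].
Qed.

Lemma Omega_star_ray (m : nat) (w : C) (t : R) : 0 < t <= 1 -> Omega_star m w ->
  Omega_star m (RtoC t * w)%C.
Proof.
  rewrite !Omega_star_iff. intros Ht [H1 H2]. split.
  - apply Cmult_neq_0; [|exact H1]. intros E. apply RtoC_inj in E. lra.
  - rewrite Cpow_mult_l, <- RtoC_pow. apply DeltaDom_star; [|exact H2].
    split; [apply pow_le; lra|]. rewrite <- (pow1 m). apply pow_incr. lra.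
Qed.

(** * Continuation along the rays of [Omega_star] *)

Definition vanishes_near (H : C -> C) (z : C) : Prop :=
  exists r, 0 < r /\ forall u, Cmod (u - z)%C < r -> H u = 0%C.

Lemma ray_dist (w : C) (s t : R) : Cmod (RtoC s * w - RtoC t * w)%C = Rabs (s - t) * Cmod w.
Proof.
  replace (RtoC s * w - RtoC t * w)%C with (RtoC (s - t) * w)%C by (rewrite RtoC_minus; ring).
  now rewrite Cmod_mult, Cmod_R.
Qed.

Lemma vanishes_near_disc (H : C -> C) (p z : C) (r : R) :
  (forall u, Cmod (u - p)%C < r -> ex_derive H u) -> vanishes_near H p ->
  Cmod (z - p)%C < r -> vanishes_near H z.
Proof.
  intros HH [s [Hs Hv]] Hz. exists (r - Cmod (z - p)%C). split; [lra|].
  intros u Hu. apply (disc_vanish H p r s Hs HH Hv).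
  replace (u - p)%C with ((u - z) + (z - p))%C by ring.
  eapply Rle_lt_trans; [apply Cmod_triangle|]. lra.
Qed.

Lemma vanishes_near_0_ball (H : C -> C) (r : R) (z : C) :
  (forall w, 0 < Cmod w < r -> H w = 0%C) -> 0 < Cmod z < r -> vanishes_near H z.
Proof.
  intros H0 Hz. exists (Rmin (Cmod z) (r - Cmod z)). split; [apply Rmin_pos; lra|].
  intros u Hu. apply H0.
  assert (H1 : Cmod (u - z)%C < Cmod z) by (eapply Rlt_le_trans; [exact Hu|apply Rmin_l]).
  assert (H2 : Cmod (u - z)%C < r - Cmod z) by (eapply Rlt_le_trans; [exact Hu|apply Rmin_r]).
  split.
  - pose proof (Cmod_triangle_inv z u) as H3. rewrite <- (Cmod_opp (z - u)%C) in H3.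
    replace (- (z - u))%C with (u - z)%C in H3 by ring. lra.
  - pose proof (Cmod_triangle_inv u z). lra.
Qed.

(** Let [T] be the supremum of the parameters up to which [H] vanishes near every point of the ray
    through [w]. A disc about a good point just before [T] reaches beyond [T], so [T = 1] and [w]
    itself is covered. *)
Lemma Omega_star_vanish (m : nat) (H : C -> C) (r : R) : 0 < r ->
  holomorphic_on (Omega_star m) H -> (forall w, 0 < Cmod w < r -> H w = 0%C) ->
  forall w, Omega_star m w -> H w = 0%C.
Proof.
  intros Hr HH H0 w Hw.
  assert (Hm : 0 < Cmod w) by (apply Cmod_gt_0, Hw).
  set (A := fun t => 0 < t <= 1 /\ forall t', 0 < t' <= t -> vanishes_near H (RtoC t' * w)%C).
  assert (Hmod : forall t, 0 <= t -> Cmod (RtoC t * w)%C = t * Cmod w).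
  { intros t Ht. now rewrite Cmod_mult, Cmod_R, Rabs_pos_eq. }
  set (t1 := Rmin 1 (r / (2 * Cmod w))).
  assert (Ht1 : 0 < t1) by (apply Rmin_pos; [lra|apply Rdiv_lt_0_compat; lra]).
  assert (HA1 : A t1).
  { split; [split; [exact Ht1|apply Rmin_l]|].
    intros t' [Ht'0 Ht'1]. apply (vanishes_near_0_ball H r); [exact H0|]. rewrite Hmod by lra.
    assert (t' <= r / (2 * Cmod w)) by (eapply Rle_trans; [exact Ht'1|apply Rmin_r]).
    assert (t' * Cmod w <= r / 2).
    { replace (r / 2) with (r / (2 * Cmod w) * Cmod w) by (field; lra).
      apply Rmult_le_compat_r; lra. }
    split; [apply Rmult_lt_0_compat; lra|lra]. }
  destruct (completeness A) as [T [HT1 HT2]].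
  { exists 1. intros t [Ht _]. lra. }
  { now exists t1. }
  assert (HT : 0 < T <= 1).
  { split; [apply Rlt_le_trans with t1; [exact Ht1|now apply HT1]|].
    apply HT2. intros t [Ht _]. lra. }
  destruct (Omega_star_open m _ (Omega_star_ray m w T HT Hw)) as [rho [Hrho D]].
  (* With [e * |w| <= rho / 4], the disc of radius [3/4 rho] about [t * w] stays in the disc of
     radius [rho] about [T * w], and it contains all points with parameter within [2 e] of [t]. *)
  set (e := Rmin T (rho / (4 * Cmod w))).
  assert (He : 0 < e) by (apply Rmin_pos; [lra|apply Rdiv_lt_0_compat; lra]).
  assert (He1 : e <= T) by apply Rmin_l.
  assert (He2 : e * Cmod w <= rho / 4).
  { replace (rho / 4) with (rho / (4 * Cmod w) * Cmod w) by (field; lra).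
    apply Rmult_le_compat_r; [lra|apply Rmin_r]. }
  assert (Ht : exists t, A t /\ T - e < t).
  { destruct (Classical_Prop.classic (exists t, A t /\ T - e < t)) as [Hex|Hno]; [exact Hex|exfalso].
    assert (T <= T - e); [|lra]. apply HT2. intros t HAt. apply Rnot_lt_le. intros Hlt.
    apply Hno. now exists t. }
  destruct Ht as [t [HAt Htlt]].
  assert (HtT : t <= T) by now apply HT1.
  assert (Hext : forall t', t - e <= t' <= T + e -> vanishes_near H (RtoC t' * w)%C).
  { intros t' Ht'. apply (vanishes_near_disc H (RtoC t * w)%C _ (3 / 4 * rho)).
    - intros u Hu. apply HH, D.
      replace (u - RtoC T * w)%C with ((u - RtoC t * w) + (RtoC t * w - RtoC T * w))%C by ring.
      eapply Rle_lt_trans; [apply Cmod_triangle|]. rewrite ray_dist.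
      assert (Rabs (t - T) <= e) by (apply Rabs_le; lra).
      assert (Rabs (t - T) * Cmod w <= e * Cmod w) by (apply Rmult_le_compat_r; lra). lra.
    - apply HAt. destruct HAt as [Ht _]. lra.
    - rewrite ray_dist. assert (Rabs (t' - t) <= 2 * e) by (apply Rabs_le; lra).
      assert (Rabs (t' - t) * Cmod w <= 2 * e * Cmod w) by (apply Rmult_le_compat_r; lra). lra. }
  assert (HA2 : A (Rmin 1 (T + e))).
  { split; [split; [apply Rmin_pos; lra|apply Rmin_l]|].
    intros t' Ht'. destruct (Rle_dec t' t) as [Hl|Hl].
    - apply HAt. lra.
    - apply Hext. split; [lra|]. eapply Rle_trans; [apply Ht'|apply Rmin_r]. }
  assert (HT' : T = 1).
  { apply HT1 in HA2. unfold Rmin in HA2. destruct (Rle_dec 1 (T + e)); lra. }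
  destruct (Hext 1 ltac:(lra)) as [s [Hs Hv]].
  apply Hv. replace (w - 1 * w)%C with (RtoC 0) by ring. rewrite Cmod_0. exact Hs.
Qed.

Lemma Croot_exists (m : nat) (z : C) : (1 <= m)%nat -> z <> 0%C ->
  exists w : C, w <> 0%C /\ (w ^ m = z)%C.
Proof.
  intros Hm Hz. exists (Cexpc (RtoC (/ INR m) * Clogp z)%C). split; [apply Cexpc_neq_0|].
  rewrite Cexpc_pow, Cmult_assoc, <- RtoC_mult, Rinv_r, Cmult_1_l by (apply not_0_INR; lia).
  now apply Cexpc_Clogp.
Qed.

(** * Series of the root-of-unity components *)

(** Compares a lacunary series with the one left after deleting its zero terms: [phi k] is the
    position of the [k]-th retained term. *)
Lemma is_series_C_unique_sub (e e' : nat -> C) (phi : nat -> nat) (s s' : C) :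
  (forall k, (k <= phi k)%nat) -> (forall k, sum_n e (phi k) = sum_n e' k :> C) ->
  is_series e s -> is_series e' s' -> s = s'.
Proof.
  intros Hphi Hs H H'.
  assert (E : Cmod (s - s')%C <= 0).
  { apply le_epsilon. intros eps He.
    destruct (is_series_C_eps _ _ H (eps / 2) ltac:(lra)) as [N1 H1].
    destruct (is_series_C_eps _ _ H' (eps / 2) ltac:(lra)) as [N2 H2].
    set (k := (N1 + N2)%nat).
    specialize (H1 (phi k) ltac:(specialize (Hphi k); unfold k in *; lia)).
    specialize (H2 k ltac:(unfold k; lia)). rewrite Hs in H1.
    set (x := (sum_n e' k : C)) in *.
    replace (s - s')%C with ((x - s') - (x - s))%C by ring.
    eapply Rle_trans; [apply Cmod_triangle|]. rewrite Cmod_opp. lra. }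
  assert (E0 : Cmod (s - s')%C = 0) by (pose proof (Cmod_ge_0 (s - s')%C); lra).
  apply Cmod_eq_0 in E0. replace s with ((s - s') + s')%C by ring. rewrite E0. ring.
Qed.

Lemma is_series_C_scal (c : C) (e : nat -> C) (s : C) :
  is_series e s -> is_series (fun k => c * e k)%C (c * s)%C.
Proof. apply (is_series_scal (K := C_AbsRing) (V := C_NormedModule)). Qed.

Lemma is_series_C_sum (e : nat -> nat -> C) (s : nat -> C) (n : nat) :
  (forall j, (j <= n)%nat -> is_series (e j) (s j)) ->
  is_series (fun k => sum_n (fun j => e j k) n : C) (sum_n s n : C).
Proof.
  intros H. induction n as [|n IH].
  - rewrite sum_n_C_0.
    apply (is_series_ext (V := C_NormedModule) (e 0%nat)); [|apply H; lia].
    intros k. symmetry. apply sum_n_C_0.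
  - rewrite sum_n_C_S.
    apply (is_series_ext (V := C_NormedModule)
             (fun k => plus (sum_n (fun j => e j k) n : C_NormedModule) (e (S n) k))).
    + intros k. symmetry. apply sum_n_C_S.
    + apply (is_series_plus (V := C_NormedModule)); [apply IH; intros; apply H; lia|apply H; lia].
Qed.

Lemma sum_n_C_gap (e : nat -> C) (N q : nat) :
  (forall i, (N < i <= N + q)%nat -> e i = RtoC 0) ->
  sum_n e (N + S q) = (sum_n e N + e (N + S q)%nat)%C :> C.
Proof.
  intros H. rewrite Nat.add_succ_r, sum_n_C_S. f_equal.
  induction q as [|q IH]; [now rewrite Nat.add_0_r|].
  rewrite Nat.add_succ_r, sum_n_C_S, IH by (intros; apply H; lia).
  rewrite (H (S (N + q))) by lia. Cring.
Qed.

Lemma mod_shift_0 (M l' k : nat) : (l' < M)%nat ->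
  ((M - l' + k) mod M = 0)%nat <-> exists j, (k = l' + M * j)%nat.
Proof.
  intros Hl. split.
  - intros H. apply Nat.Div0.div_exact in H. set (q := ((M - l' + k) / M)%nat) in *.
    destruct q as [|q]; [lia|]. exists q. nia.
  - intros [j ->]. replace (M - l' + (l' + M * j))%nat with ((j + 1) * M)%nat by nia.
    apply Nat.Div0.mod_mul.
Qed.

(** Averaging over the rotations of [w] keeps the exponents congruent to [l'] modulo [S M]. The
    coefficient [c (S k)] stands with exponent [k] because multiplication by [w^(m-1)] turns
    [w^(n-m)] into [w^(n-1)]; thus [l' = l - 1]. *)
Lemma roots_average (c : nat -> C) (Phi : C -> C) (M l' : nat) (w s : C) : (l' <= M)%nat ->
  (forall j, is_series (fun k => c (S k) * (rootu (S M) ^ j * w) ^ k)%C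
                       (Phi (rootu (S M) ^ j * w)%C)) ->
  is_series (fun k => c (S l' + S M * k)%nat * (w ^ S M) ^ k)%C s ->
  sum_n (fun j => (rootu (S M) ^ j) ^ (S M - l') * Phi (rootu (S M) ^ j * w))%C M
    = (RtoC (INR (S M)) * w ^ l' * s)%C :> C.
Proof.
  intros Hl HPhi Hs.
  set (m := S M). set (om := rootu m).
  set (e := fun k => sum_n (fun j => (om ^ j) ^ (m - l') * (c (S k) * (om ^ j * w) ^ k))%C M : C).
  assert (He : is_series e (sum_n (fun j => (om ^ j) ^ (m - l') * Phi (om ^ j * w))%C M : C)).
  { apply (is_series_C_sum (fun j k => (om ^ j) ^ (m - l') * (c (S k) * (om ^ j * w) ^ k))%C).
    intros j _. apply is_series_C_scal, HPhi. }
  assert (Ee : forall k, e k = if Nat.eqb ((m - l' + k) mod m) 0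
                               then (RtoC (INR m) * (c (S k) * w ^ k))%C else RtoC 0).
  { intros k. unfold e.
    rewrite (sum_n_ext _ (fun j => (c (S k) * w ^ k) * (om ^ j) ^ (m - l' + k))%C).
    2:{ intros j. rewrite Cpow_mult_l, Cpow_add_r. Cring. }
    rewrite sum_n_C_scal. unfold om, m. rewrite rootu_orthogonality.
    destruct (Nat.eqb _ _); ring. }
  assert (E0 : forall k, ~ (exists j, (k = l' + m * j)%nat) -> e k = RtoC 0).
  { intros k Hk. rewrite Ee. destruct (Nat.eqb_spec ((m - l' + k) mod m) 0) as [Z|Z]; [|reflexivity].
    exfalso. apply Hk, mod_shift_0; [unfold m; lia|exact Z]. }
  assert (E1 : forall j, e (l' + m * j)%nat =
            (RtoC (INR m) * w ^ l' * (c (S l' + m * j)%nat * (w ^ m) ^ j))%C).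
  { intros j. rewrite Ee.
    destruct (Nat.eqb_spec ((m - l' + (l' + m * j)) mod m) 0) as [Z|Z].
    - rewrite Cpow_add_r, Cpow_mult_r. simpl Nat.add. ring.
    - exfalso. apply Z, mod_shift_0; [unfold m; lia|now exists j]. }
  apply (is_series_C_unique_sub e
           (fun k => RtoC (INR m) * w ^ l' * (c (S l' + m * k)%nat * (w ^ m) ^ k))%C
           (fun k => (l' + m * k)%nat)).
  - intros k. unfold m. nia.
  - intros k. induction k as [|k IH].
    + rewrite Nat.mul_0_r, Nat.add_0_r.
      rewrite (sum_n_C_single e l' l' (Nat.le_refl _)).
      * rewrite sum_n_C_0, <- E1. f_equal. lia.
      * intros i Hi Hne. apply E0. intros [j Hj]. nia.
    + replace (l' + m * S k)%nat with ((l' + m * k) + S M)%nat by (unfold m; lia).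
      rewrite sum_n_C_gap, IH, sum_n_C_S.
      * f_equal. rewrite <- E1. f_equal. unfold m; lia.
      * intros i Hi. apply E0. intros [j Hj].
        assert (k < j)%nat by (unfold m in *; nia). assert (j < S k)%nat by (unfold m in *; nia). lia.
  - exact He.
  - apply is_series_C_scal. exact Hs.
Qed.

Lemma CpowZ_mult_pow (w : C) (z : Z) (n k : nat) : w <> 0%C -> (z + Z.of_nat n = Z.of_nat k)%Z ->
  (CpowZ w z * w ^ n = w ^ k)%C.
Proof.
  intros Hw E. destruct z as [|p|p]; simpl CpowZ.
  - replace k with n by lia. ring.
  - rewrite pow_n_Cpow, <- Cpow_add_r. f_equal. lia.
  - rewrite pow_n_Cpow. replace n with (Pos.to_nat p + k)%nat by lia.
    rewrite Cpow_add_r. field. now apply Cpow_nz.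
Qed.

Lemma Cexpc_eq_1 (z : C) : - PI / 2 < Im z < PI / 2 -> Cexpc z = 1%C -> z = 0%C.
Proof.
  intros Hz E. rewrite <- (Clogp_Cexpc z Hz), E, <- Cexpc_0. apply Clogp_Cexpc.
  unfold Im; simpl. pose proof PI_RGT_0. lra.
Qed.

(** Multiplied by [m], the exponent [l/m - 1] becomes the integer [l - m], for which the choice of
    logarithm no longer matters. *)
Lemma Cpowr_pow_cancel (q : C) (m l : nat) : q <> 0%C -> (1 <= l <= m)%nat ->
  (Cpowr q (INR l / INR m - 1) ^ m * q ^ (m - l) = 1)%C.
Proof.
  intros Hq Hl. unfold Cpowr. rewrite Cexpc_pow.
  rewrite <- (Cexpc_Clogp q Hq) at 2. rewrite Cexpc_pow, <- Cexpc_plus, <- Cexpc_0.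
  f_equal. rewrite Cmult_assoc, <- RtoC_mult, <- Cmult_plus_distr_r, <- RtoC_plus.
  rewrite minus_INR by lia.
  replace (INR m * (INR l / INR m - 1) + (INR m - INR l)) with 0
    by (field; apply not_0_INR; lia).
  ring.
Qed.

Lemma pow_le_reg (x y : R) (n : nat) : 0 <= y -> (1 <= n)%nat -> x ^ n <= y ^ n -> x <= y.
Proof.
  intros Hy Hn H. apply Rnot_lt_le. intros Hlt.
  assert (y ^ n < x ^ n); [|lra].
  destruct n as [|n]; [lia|]. simpl.
  assert (Hp : y ^ n <= x ^ n) by (apply pow_incr; lra).
  pose proof (pow_lt x n ltac:(lra)). nra.
Qed.

(** * Growth of [g_l] and of the coefficients *)

Lemma ex_derive_C_sum (f : nat -> C -> C) (n : nat) (z : C) :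
  (forall j, ex_derive (f j) z) -> ex_derive (fun w => sum_n (fun j => f j w) n : C) z.
Proof.
  intros H. induction n as [|n IH].
  - apply (ex_derive_ext (f 0%nat)); [intros w; symmetry; apply sum_n_C_0|apply H].
  - apply (ex_derive_ext (fun w => (sum_n (fun j => f j w) n : C) + f (S n) w)%C);
      [intros w; symmetry; apply sum_n_C_S|].
    now apply ex_derive_C_plus.
Qed.

Lemma Omega_star_rootu (M j : nat) (w : C) :
  Omega_star (S M) w -> Omega_star (S M) (rootu (S M) ^ j * w)%C.
Proof.
  rewrite !Omega_star_iff. intros [H1 H2].
  rewrite Cpow_mult_l, <- Cpow_mult_r, Nat.mul_comm, Cpow_mult_r, rootu_pow_N, Cpow_1_l by lia.
  rewrite Cmult_1_l. split; [|exact H2].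
  apply Cmult_neq_0; [|exact H1]. apply Cpow_nz, Cexpc_neq_0.
Qed.

Lemma Cmod_rootu_mult (m j : nat) (w : C) : Cmod (rootu m ^ j * w)%C = Cmod w.
Proof. rewrite Cmod_mult, Cmod_rootu_pow. ring. Qed.

(* [m] times the part of [w^(m-1) Ft(w)] made of the powers [w^k] with [k = l' mod m]. *)
Definition roots_part (m l' : nat) (Ft : C -> C) (w : C) : C :=
  sum_n (fun j => (rootu m ^ j) ^ (m - l') *
                  (Ft (rootu m ^ j * w) * (rootu m ^ j * w) ^ (m - 1)))%C (m - 1).

Lemma roots_part_holomorphic (M l' : nat) (Ft : C -> C) :
  holomorphic_on (Omega_star (S M)) Ft ->
  holomorphic_on (Omega_star (S M)) (roots_part (S M) l' Ft).
Proof.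
  intros HF w Hw. unfold roots_part.
  apply (ex_derive_C_sum (fun j w => (rootu (S M) ^ j) ^ (S M - l') *
    (Ft (rootu (S M) ^ j * w) * (rootu (S M) ^ j * w) ^ (S M - 1)))%C).
  intros j. apply ex_derive_C_mult; [apply ex_derive_C_const|].
  apply ex_derive_C_mult.
  - apply (ex_derive_C_comp Ft (fun w => rootu (S M) ^ j * w)%C); [|apply ex_derive_C_scal].
    now apply HF, Omega_star_rootu.
  - apply ex_derive_C_pow, ex_derive_C_scal.
Qed.

Lemma roots_part_bound (M l' : nat) (Ft : C -> C) (A B : R) :
  (forall w, Omega_star (S M) w ->
     Cmod (Ft w * pow_n w (S M - 1))%C <= A * exp (B * Cmod (cov_proj (S M) w))) ->
  forall w, Omega_star (S M) w ->
    Cmod (roots_part (S M) l' Ft w) <= INR (S M) * (A * exp (B * Cmod w ^ S M)).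
Proof.
  intros HB w Hw. unfold roots_part.
  eapply Rle_trans; [apply Cmod_sum_n|].
  replace (INR (S M)) with (INR (S (S M - 1))) by (f_equal; lia).
  rewrite <- sum_n_const. apply sum_n_le_loc. intros j _.
  specialize (HB _ (Omega_star_rootu M j w Hw)).
  rewrite Cmod_mult, Cmod_pow, Cmod_rootu_pow, pow1, Rmult_1_l.
  rewrite <- (Cmod_rootu_mult (S M) j w), <- Cmod_pow, <- !pow_n_Cpow. exact HB.
Qed.

Lemma roots_part_series (M l' : nat) (a : nat -> C) (Ft : C -> C) (w s : C) : (l' <= M)%nat ->
  w <> 0%C ->
  (forall j, is_series (fun k => a (S k) *
       CpowZ (rootu (S M) ^ j * w) (Z.of_nat (S k) - Z.of_nat (S M))
       / RtoC (Gamma (INR (S k) / INR (S M))))%C (Ft (rootu (S M) ^ j * w)%C)) ->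
  is_series (fun k => a (S l' + S M * k)%nat * pow_n (w ^ S M)%C k
       / RtoC (Gamma (INR (S l') / INR (S M) + INR k)))%C s ->
  roots_part (S M) l' Ft w = (RtoC (INR (S M)) * w ^ l' * s)%C.
Proof.
  intros Hl Hw HFt Hs. unfold roots_part. replace (S M - 1)%nat with M by lia.
  apply (roots_average (fun n => a n / RtoC (Gamma (INR n / INR (S M))))%C
           (fun w => Ft w * w ^ M)%C); [exact Hl| |].
  - intros j. set (v := (rootu (S M) ^ j * w)%C).
    assert (Hv : v <> 0%C) by (apply Cmult_neq_0; [apply Cpow_nz, Cexpc_neq_0|exact Hw]).
    rewrite (Cmult_comm (Ft v)).
    apply (is_series_ext (V := C_NormedModule) (fun k => v ^ M * (a (S k) *
       CpowZ v (Z.of_nat (S k) - Z.of_nat (S M)) / RtoC (Gamma (INR (S k) / INR (S M)))))%C).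
    + intros k. unfold Cdiv.
      rewrite <- (CpowZ_mult_pow v (Z.of_nat (S k) - Z.of_nat (S M)) M k Hv) by lia. Cring.
    + apply is_series_C_scal, HFt.
  - revert Hs. apply (is_series_ext (V := C_NormedModule)). intros k. rewrite pow_n_Cpow.
    replace (INR (S l' + S M * k) / INR (S M)) with (INR (S l') / INR (S M) + INR k).
    + unfold Cdiv. Cring.
    + rewrite plus_INR, mult_INR. field. apply not_0_INR. lia.
Qed.

(* After raising to the power [m] the principal branch disappears, and the relation
   between [G] and [Ft] becomes an identity between functions holomorphic on
   [Omega_star], which can be continued from a neighbourhood of [0]. *)
Lemma G_bound (m l : nat) (a : nat -> C) (A B : R) (Ft G : C -> C) : (1 <= l <= m)%nat ->
  (exists r, 0 < r /\ forall w, 0 < Cmod w < r ->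
     is_series (fun k => a (S k) * CpowZ w (Z.of_nat (S k) - Z.of_nat m)
                          / RtoC (Gamma (INR (S k) / INR m)))%C (Ft w)) ->
  holomorphic_on (Omega_star m) Ft ->
  (forall w, Omega_star m w ->
     Cmod (Ft w * pow_n w (m - 1))%C <= A * exp (B * Cmod (cov_proj m w))) ->
  holomorphic_on DeltaDom G ->
  (exists r, 0 < r /\ forall xi, 0 < Cmod xi < r ->
     exists S : C,
       is_series (fun k => a (l + m * k)%nat * pow_n xi k
                           / RtoC (Gamma (INR l / INR m + INR k)))%C S /\
       G xi = (Cpowr (xi / (1 - Cexpc (- xi))) (INR l / INR m - 1)%R * S)%C) ->
  forall w, Omega_star m w -> Cmod (G (w ^ m)%C) * Cmod w ^ (m - 1) <= A * exp (B * Cmod w ^ m).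
Proof.
  intros Hl [r1 [Hr1 HFt]] HholF HbF HholG [r2 [Hr2 HG]] w Hw.
  destruct m as [|M]; [lia|]. destruct l as [|l']; [lia|].
  set (m := S M) in *.
  set (Q := roots_part m l' Ft).
  set (H := fun w => ((RtoC (INR m) * (G (w ^ m) * w ^ (m - 1))) ^ m
                      - (1 - Cexpc (- w ^ m)) ^ (m - S l') * Q w ^ m)%C).
  assert (HholH : holomorphic_on (Omega_star m) H).
  { intros z Hz. unfold H. apply ex_derive_C_minus.
    - apply ex_derive_C_pow, ex_derive_C_mult; [apply ex_derive_C_const|].
      apply ex_derive_C_mult; [|apply ex_derive_C_pow, ex_derive_C_id].
      apply (ex_derive_C_comp G (fun w => w ^ m)%C); [|apply ex_derive_C_pow, ex_derive_C_id].
      apply HholG. apply Omega_star_iff in Hz. apply Hz.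
    - apply ex_derive_C_mult; apply ex_derive_C_pow.
      + apply ex_derive_C_minus; [apply ex_derive_C_const|].
        apply (ex_derive_C_comp Cexpc (fun w => - w ^ m)%C); [apply ex_derive_Cexpc|].
        apply (ex_derive_ext (fun w => 0 - w ^ m)%C); [intros; Cring|].
        apply ex_derive_C_minus; [apply ex_derive_C_const|apply ex_derive_C_pow, ex_derive_C_id].
      + now apply roots_part_holomorphic. }
  (* The bound 1 gives [|z^m| <= |z| < 1], so [xi = z^m] is within reach of both local series, and
     [|Im xi| < pi/2], so [1 - exp(-xi)] vanishes only at [xi = 0]. *)
  set (r := Rmin 1 (Rmin r1 r2)).
  assert (Hr : 0 < r) by (repeat apply Rmin_pos; lra).
  assert (Hr0 : r <= 1) by apply Rmin_l.
  assert (Hr1' : r <= r1) by (eapply Rle_trans; [apply Rmin_r|apply Rmin_l]).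
  assert (Hr2' : r <= r2) by (eapply Rle_trans; [apply Rmin_r|apply Rmin_r]).
  assert (Hloc : forall z, 0 < Cmod z < r -> H z = 0%C).
  { intros z Hz.
    assert (Hz0 : z <> 0%C) by (apply Cmod_gt_0; lra).
    set (xi := (z ^ m)%C).
    assert (Hxi0 : xi <> 0%C) by now apply Cpow_nz.
    assert (Hxi : Cmod xi <= Cmod z).
    { unfold xi. rewrite Cmod_pow. unfold m. simpl.
      assert (Cmod z ^ M <= 1) by (rewrite <- (pow1 M); apply pow_incr; lra).
      pose proof (pow_le (Cmod z) M ltac:(lra)). nra. }
    pose proof (proj1 (Cmod_gt_0 xi) Hxi0) as Hxip.
    destruct (HG xi ltac:(lra)) as [s [Hs HGs]].
    assert (HQ : Q z = (RtoC (INR m) * z ^ l' * s)%C).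
    { apply (roots_part_series M l' a Ft); [lia|exact Hz0| |exact Hs].
      intros j. apply HFt. fold m. rewrite Cmod_rootu_mult. lra. }
    assert (Hd : (1 - Cexpc (- xi))%C <> 0%C).
    { intros E. apply Hxi0.
      assert (E1 : Cexpc (- xi)%C = 1%C).
      { replace (Cexpc (- xi)) with (1 - (1 - Cexpc (- xi)))%C by ring. rewrite E. ring. }
      apply Cexpc_eq_1 in E1.
      - replace xi with (- - xi)%C by ring. rewrite E1. ring.
      - pose proof (im_le_Cmod (- xi)%C) as Him. rewrite Cmod_opp in Him.
        apply Rabs_le_between in Him. pose proof PI2_1. lra. }
    set (D := (1 - Cexpc (- xi))%C) in *. set (q := (xi / D)%C) in *.
    assert (Hq0 : q <> 0%C).
    { unfold q, Cdiv. apply Cmult_neq_0; [exact Hxi0|].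
      intros E. pose proof (Cinv_r D Hd) as F. rewrite E, Cmult_0_r in F.
      apply RtoC_inj in F. lra. }
    pose proof (Cpowr_pow_cancel q m (S l') Hq0 ltac:(unfold m; lia)) as Hc.
    set (P := Cpowr q (INR (S l') / INR m - 1)) in *.
    assert (ExD : (xi = q * D)%C) by (unfold q; field; exact Hd).
    unfold H. fold xi. rewrite HGs, HQ. fold D.
    (* The exponents agree since [m (m-1) = m (m-l) + m l'] with [l = l' + 1]. The part [xi^(m-l)]
       is what cancels the [m]-th power of the principal power, up to [D^(m-l)]. *)
    assert (Ez : ((z ^ (m - 1)) ^ m = xi ^ (m - S l') * (z ^ l') ^ m)%C).
    { unfold xi. rewrite <- !Cpow_mult_r, <- Cpow_add_r. f_equal. unfold m. nia. }
    rewrite !Cpow_mult_l, Ez. rewrite ExD at 1. rewrite Cpow_mult_l.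
    transitivity ((P ^ m * q ^ (m - S l') - 1) *
      (RtoC (INR m) ^ m * s ^ m * D ^ (m - S l') * (z ^ l') ^ m))%C; [ring|].
    rewrite Hc. ring. }
  assert (HH : H w = 0%C) by now apply (Omega_star_vanish m H r).
  assert (E : ((RtoC (INR m) * (G (w ^ m) * w ^ (m - 1))) ^ m
                      = (1 - Cexpc (- w ^ m)) ^ (m - S l') * Q w ^ m)%C).
  { unfold H in HH.
    match goal with |- ?x = ?y => replace x with ((x - y) + y)%C by ring end.
    rewrite HH. ring. }
  apply (f_equal Cmod) in E.
  rewrite Cmod_mult, !Cmod_pow, !Cmod_mult, Cmod_pow, Cmod_R, Rabs_pos_eq in E by apply pos_INR.
  assert (HD : Cmod (1 - Cexpc (- w ^ m))%C <= 1).
  { destruct (proj1 (Omega_star_iff m w) Hw) as [_ Hw1].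
    destruct (proj1 (DeltaDom_iff _) Hw1) as [_ Hw2]. unfold D11 in Hw2. rewrite <- Cmod_opp in Hw2.
    replace (- (Cexpc (- w ^ m) - 1))%C with (1 - Cexpc (- w ^ m))%C in Hw2 by ring. lra. }
  pose proof (roots_part_bound M l' Ft A B HbF w Hw) as HQ. fold m in HQ. fold Q in HQ.
  assert (Hmp : 0 < INR m) by (apply lt_0_INR; unfold m; lia).
  assert (Hle : INR m * (Cmod (G (w ^ m)%C) * Cmod w ^ (m - 1)) <= Cmod (Q w)).
  { apply (pow_le_reg _ _ m); [apply Cmod_ge_0|unfold m; lia|]. rewrite E.
    assert (Cmod (1 - Cexpc (- w ^ m))%C ^ (m - S l') <= 1).
    { eapply Rle_trans; [apply pow_incr; split; [apply Cmod_ge_0|exact HD]|].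
      rewrite pow1. apply Rle_refl. }
    pose proof (pow_le (Cmod (Q w)) m (Cmod_ge_0 _)). nra. }
  apply Rmult_le_reg_l with (INR m); [exact Hmp|]. lra.
Qed.

(** Since [|s| < 2], adding [2 ln 2] compensates a positive [ln |s|]. The coefficient of [- ln |s|]
    is exactly 1, so the rate in [xi] is transferred to the power of [|s|] without loss. *)
Lemma Cmod_Clogp_bound (s : C) : D11 s -> Cmod (Clogp s) <= 2 * ln 2 + PI / 2 - ln (Cmod s).
Proof.
  intros Hs. pose proof (D11_Re_pos s Hs) as Hp.
  pose proof (Cargp_bound s Hp) as Ha.
  pose proof (proj1 (Cmod_gt_0 s) (Re_pos_neq_0 s Hp)) as Hm.
  assert (Hm2 : Cmod s < 2).
  { unfold D11 in Hs. replace s with ((s - 1) + 1)%C by ring.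
    eapply Rle_lt_trans; [apply Cmod_triangle|]. rewrite Cmod_1. lra. }
  eapply Rle_trans; [apply Cmod_le_Re_Im|]. unfold Clogp, Re, Im; simpl.
  assert (Rabs (Cargp s) <= PI / 2) by (apply Rabs_le; lra).
  assert (ln (Cmod s) <= ln 2) by (apply ln_le; lra).
  assert (0 < ln 2) by (rewrite <- ln_1; apply ln_increasing; lra).
  assert (Rabs (ln (Cmod s)) <= 2 * ln 2 - ln (Cmod s)) by (apply Rabs_le; lra).
  lra.
Qed.

(** The available bound carries the factor [|w|^(m-1)] and degenerates at the origin. Since 0 is
    interior to [DeltaDom], continuity of [G] there bounds it near 0, and away from 0 the factor is
    bounded below. *)
Lemma G_log_bound (m : nat) (A B beta : R) (G : C -> C) : (1 <= m)%nat -> 0 < A -> B <= beta -> 0 < beta ->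
  holomorphic_on DeltaDom G ->
  (forall w, Omega_star m w -> Cmod (G (w ^ m)%C) * Cmod w ^ (m - 1) <= A * exp (B * Cmod w ^ m)) ->
  exists K, 0 <= K /\ forall s, D11 s -> Cmod (G (- Clogp s)%C) <= K * Rpower (Cmod s) (- beta).
Proof.
  intros Hm HA HB Hbeta HholG HG.
  assert (H0 : DeltaDom 0%C).
  { apply DeltaDom_iff_cos. unfold Re, Im; simpl. rewrite Ropp_0, exp_0, cos_0.
    pose proof PI_RGT_0. lra. }
  destruct (ex_derive_C_continuous G 0%C (HholG _ H0) 1 Rlt_0_1) as [c [Hc Dc]].
  (* If [|w| < c1] then [|w^m| <= |w| < c]; hence [|xi| >= c] forces [|w| >= c1] for every [m]-th
     root [w] of [xi]. *)
  set (c1 := Rmin 1 c). assert (Hc1 : 0 < c1) by (apply Rmin_pos; lra).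
  set (M0 := Cmod (G 0%C) + 1). assert (HM0 : 0 < M0) by (pose proof (Cmod_ge_0 (G 0%C)); unfold M0; lra).
  set (M1 := A / c1 ^ (m - 1)).
  assert (Hcp : 0 < c1 ^ (m - 1)) by now apply pow_lt.
  assert (HM1 : 0 < M1) by (apply Rdiv_lt_0_compat; assumption).
  set (K0 := exp (beta * (2 * ln 2 + PI / 2))). assert (HK0 : 0 < K0) by apply exp_pos.
  exists ((M0 + M1) * K0). split; [nra|].
  intros s Hs. set (xi := (- Clogp s)%C).
  assert (Hxi : DeltaDom xi) by now exists s.
  assert (Hexp : exp (beta * Cmod xi) <= K0 * Rpower (Cmod s) (- beta)).
  { unfold K0, Rpower. rewrite <- exp_plus. apply exp_le_compat.
    unfold xi. rewrite Cmod_opp. pose proof (Cmod_Clogp_bound s Hs). nra. }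
  assert (He1 : 1 <= exp (beta * Cmod xi)).
  { rewrite <- exp_0. apply exp_le_compat. pose proof (Cmod_ge_0 xi). nra. }
  assert (Hmain : Cmod (G xi) <= (M0 + M1) * exp (beta * Cmod xi)).
  { destruct (Rlt_dec (Cmod xi) c) as [Hlt|Hge].
    - assert (Hd : Cmod (xi - 0)%C < c) by (replace (xi - 0)%C with xi by ring; exact Hlt).
      specialize (Dc _ Hd). pose proof (Cmod_triangle_inv (G xi) (G 0%C)). unfold M0 in *. nra.
    - apply Rnot_lt_le in Hge.
      assert (Hxi0 : xi <> 0%C) by (apply Cmod_gt_0; lra).
      destruct (Croot_exists m xi Hm Hxi0) as [w [Hw0 Hw]].
      assert (HwO : Omega_star m w) by (apply Omega_star_iff; rewrite Hw; now split).
      specialize (HG w HwO). rewrite <- (Cmod_pow w m), Hw in HG.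
      assert (Hwc : c1 <= Cmod w).
      { apply Rnot_lt_le. intros Hlt.
        assert (H1 : Cmod w < 1) by (eapply Rlt_le_trans; [exact Hlt|apply Rmin_l]).
        assert (H2 : Cmod w < c) by (eapply Rlt_le_trans; [exact Hlt|apply Rmin_r]).
        rewrite <- Hw, Cmod_pow in Hge. destruct m as [|M]; [lia|]. simpl in Hge.
        pose proof (Cmod_ge_0 w).
        assert (Cmod w ^ M <= 1) by (rewrite <- (pow1 M); apply pow_incr; lra).
        pose proof (pow_le (Cmod w) M ltac:(lra)). nra. }
      assert (Hpw : c1 ^ (m - 1) <= Cmod w ^ (m - 1)) by (apply pow_incr; lra).
      assert (HBb : exp (B * Cmod xi) <= exp (beta * Cmod xi)).
      { apply exp_le_compat. pose proof (Cmod_ge_0 xi). nra. }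
      assert (H1 : Cmod (G xi) * c1 ^ (m - 1) <= A * exp (beta * Cmod xi)).
      { apply Rle_trans with (Cmod (G xi) * Cmod w ^ (m - 1)).
        - apply Rmult_le_compat_l; [apply Cmod_ge_0|exact Hpw].
        - eapply Rle_trans; [exact HG|]. apply Rmult_le_compat_l; lra. }
      assert (H2 : Cmod (G xi) <= M1 * exp (beta * Cmod xi)).
      { apply Rmult_le_reg_r with (c1 ^ (m - 1)); [exact Hcp|].
        replace (M1 * exp (beta * Cmod xi) * c1 ^ (m - 1)) with (A * exp (beta * Cmod xi))
          by (unfold M1; field; lra). exact H1. }
      nra. }
  eapply Rle_trans; [exact Hmain|]. rewrite Rmult_assoc.
  apply Rmult_le_compat_l; [lra|exact Hexp].
Qed.

Lemma uniform_bound (P : nat -> R -> Prop) (m : nat) :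
  (forall l x y, P l x -> x <= y -> P l y) ->
  (forall l, (1 <= l <= m)%nat -> exists K, P l K) ->
  exists K, 0 <= K /\ forall l, (1 <= l <= m)%nat -> P l K.
Proof.
  intros Hmono H. induction m as [|m IH].
  - exists 0. split; [lra|]. intros l Hl. lia.
  - destruct IH as [K1 [HK1 H1]]; [intros l Hl; apply H; lia|].
    destruct (H (S m) ltac:(lia)) as [K2 H2].
    exists (Rmax K1 K2). split; [eapply Rle_trans; [exact HK1|apply Rmax_l]|].
    intros l Hl. destruct (Nat.eq_dec l (S m)) as [->|Hne].
    + apply (Hmono _ K2); [exact H2|apply Rmax_r].
    + apply (Hmono _ K1); [apply H1; lia|apply Rmax_l].
Qed.

Theorem lemma5p4 (m : nat) (a : nat -> C) (A B : R) (Ft : C -> C) :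
  (1 <= m)%nat ->
  gevrey1 m a ->
  (* Borel transform: Ft(zeta) = sum_{n>=1} a_n zeta^(n/m - 1) / Gamma(n/m)
     near 0 on the covering (zeta^(n/m-1) = w^(n-m) in the chart w) *)
  (exists r, 0 < r /\ forall w, 0 < Cmod w < r ->
     is_series (fun k => a (S k) * CpowZ w (Z.of_nat (S k) - Z.of_nat m)
                          / RtoC (Gamma (INR (S k) / INR m)))%C (Ft w)) ->
  (* analytic continuation to Omega* *)
  holomorphic_on (Omega_star m) Ft ->
  0 < A -> 0 < B ->
  (* |Ft(zeta) zeta^((m-1)/m)| <= A e^(B|zeta|) on Omega* *)
  (forall w, Omega_star m w ->
     Cmod (Ft w * pow_n w (m - 1))%C <= A * exp (B * Cmod (cov_proj m w))) ->
  forall d : nat -> C,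
  (* definition of d_n, n = l + m j, l = 1..m, j >= 0 *)
  (forall l : nat, (1 <= l <= m)%nat ->
     exists G : C -> C,
       holomorphic_on DeltaDom G /\
       (exists r, 0 < r /\ forall xi, 0 < Cmod xi < r ->
          exists S : C,
            is_series (fun k => a (l + m * k)%nat * pow_n xi k
                                / RtoC (Gamma (INR l / INR m + INR k)))%C S /\
            G xi = (Cpowr (xi / (1 - Cexpc (- xi))) (INR l / INR m - 1)%R * S)%C) /\
       (forall s, D11 s ->
          is_pseries (fun j => d (l + m * j)%nat) (1 - s)%C (G (- Clogp s)%C))) ->
  forall Cexp0 : R, Rmax B 1 < Cexp0 ->
  ex_series (fun n => Cmod (d (S n)) / Rpower (INR (S n) / INR m) Cexp0).
Proof.
  intros Hm _ HFt HholF HA HB HbF d Hd Cexp0 HC.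
  (* The midpoint leaves room on both sides: above 1 and [B] for the coefficient bound, and below
     [Cexp0] so that the final exponent [Cexp0 - beta + 1] exceeds 1. *)
  set (beta := (Rmax B 1 + Cexp0) / 2).
  assert (Hb1 : 1 < beta) by (pose proof (Rmax_r B 1); unfold beta; lra).
  assert (HbB : B <= beta) by (pose proof (Rmax_l B 1); unfold beta; lra).
  assert (HbC : beta < Cexp0) by (unfold beta; lra).
  assert (Hl : forall l, (1 <= l <= m)%nat -> exists K, forall j,
    Cmod (d (l + m * j)%nat) <= K * Rpower (INR j + 2) (beta - 1)).
  { intros l Hl. destruct (Hd l Hl) as [G [HholG [Hloc Hps]]].
    pose proof (G_bound m l a A B Ft G Hl HFt HholF HbF HholG Hloc) as HGb.
    destruct (G_log_bound m A B beta G Hm HA HbB ltac:(lra) HholG HGb) as [K [HK Hbound]].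
    assert (HD : forall u, Cmod u < 1 -> D11 (1 - u)%C).
    { intros u Hu. unfold D11. replace (1 - u - 1)%C with (- u)%C by ring. now rewrite Cmod_opp. }
    eexists. intros j.
    apply (coef_growth (fun j => d (l + m * j)%nat) (fun u => G (- Clogp (1 - u))%C) K beta Hb1 HK).
    - intros u Hu. specialize (Hps _ (HD u Hu)).
      replace (1 - (1 - u))%C with u in Hps by ring. exact Hps.
    - intros u Hu. apply Hbound, HD, Hu. }
  apply uniform_bound in Hl.
  2:{ intros l x y Hx Hxy j. eapply Rle_trans; [apply Hx|].
      apply Rmult_le_compat_r; [left; apply exp_pos|exact Hxy]. }
  destruct Hl as [K [HK Hl]].
  assert (Hmp : 0 < INR m) by (apply lt_0_INR; lia).
  assert (Hdn : forall n, Cmod (d (S n)) <= K * Rpower 2 (beta - 1) * Rpower (INR (S n)) (beta - 1)).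
  { intros n.
    (* Dividing [n] rather than [n + 1] by [m] gives [S n = S l + m * j] with the residue index
       [S l] in the range from 1 to [m]. *)
    pose proof (Nat.div_mod_eq n m) as En. pose proof (Nat.mod_upper_bound n m ltac:(lia)) as Hmod.
    set (j := (n / m)%nat) in *. set (l := (n mod m)%nat) in *.
    specialize (Hl (S l) ltac:(lia) j).
    replace (S l + m * j)%nat with (S n) in Hl by lia.
    eapply Rle_trans; [exact Hl|]. rewrite Rmult_assoc. apply Rmult_le_compat_l; [exact HK|].
    assert (Hjn : INR j + 2 <= 2 * INR (S n)).
    { rewrite S_INR. assert (INR j <= INR n) by (apply le_INR; nia).
      pose proof (pos_INR n). lra. }
    pose proof (pos_INR j).
    rewrite Rpower_mult_distr by (try lra; apply lt_0_INR; lia).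
    apply Rle_Rpower_l; [lra|]. split; lra. }
  apply (ex_series_le (V := R_CompleteNormedModule) _
    (fun n => (K * Rpower 2 (beta - 1) * Rpower (INR m) Cexp0)
              * Rpower (INR (S n)) (- (Cexp0 - beta + 1)))).
  - intros n.
    assert (Hn : 0 < INR (S n)) by (apply lt_0_INR; lia).
    assert (HR : / Rpower (INR (S n) / INR m) Cexp0
                 = Rpower (INR m) Cexp0 * Rpower (INR (S n)) (- Cexp0)).
    { rewrite <- Rpower_Ropp. unfold Rpower. rewrite <- exp_plus. f_equal.
      rewrite ln_div by assumption. ring. }
    change (Rabs (Cmod (d (S n)) / Rpower (INR (S n) / INR m) Cexp0) <=
      (K * Rpower 2 (beta - 1) * Rpower (INR m) Cexp0) * Rpower (INR (S n)) (- (Cexp0 - beta + 1))).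
    unfold Rdiv at 1. rewrite HR.
    pose proof (exp_pos (Cexp0 * ln (INR m))) as P1. fold (Rpower (INR m) Cexp0) in P1.
    pose proof (exp_pos (- Cexp0 * ln (INR (S n)))) as P2. fold (Rpower (INR (S n)) (- Cexp0)) in P2.
    rewrite Rabs_pos_eq.
    2:{ apply Rmult_le_pos; [apply Cmod_ge_0|]. apply Rmult_le_pos; lra. }
    replace (- (Cexp0 - beta + 1)) with ((beta - 1) + - Cexp0) by ring. rewrite Rpower_plus.
    specialize (Hdn n).
    apply Rmult_le_compat_r with (r := Rpower (INR m) Cexp0 * Rpower (INR (S n)) (- Cexp0)) in Hdn;
      [|apply Rmult_le_pos; lra].
    lra.
  - apply (ex_series_scal (V := R_NormedModule)), ex_series_Rpower. lra.
Qed.
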